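(* Let $P_1,P_2,\dots,P_{d+1}\subset\mathbb{R}^d$ be disjoint $n$-element point sets with $P_1\cup\cdots\cup P_{d+1}$ in general position. Then there is a point $q\in\mathbb{R}^d$ and subsets $P_1'\subset P_1,\dots,P_{d+1}'\subset P_{d+1}$, with $$|P_i'|\ \ge\ 2^{-O(d^2\log(d+1))}\,|P_i| ,$$ where the constant implied by $O(\cdot)$ is absolute (independent of $d$, $n$ and the sets), such that all closed simplices with one vertex from each $P_i'$ contain $q$.
   Context: A point set in $\mathbb{R}^d$ is in general position if no $d+1$ of its points lie in a common hyperplane. *)

(* Defs.v *)
From HB Require Import structures.
From mathcomp Require Import all_boot all_order all_algebra finmap.
From mathcomp Require Import boolp classical_sets reals.

Set Implicit Arguments.
Unset Strict Implicit.
Unset Printing Implicit Defensive.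

Import Order.TTheory GRing.Theory Num.Theory.

Local Open Scope classical_set_scope.
Local Open Scope ring_scope.

Definition hyperplane (R : realType) (d : nat) (H : set 'rV[R]_d) : Prop :=
  exists (a : 'rV[R]_d) (b : R),
    a != 0 /\ H = [set x : 'rV[R]_d | \sum_(j < d) a 0 j * x 0 j = b].

Definition general_position (R : realType) (d : nat) (S : {fset 'rV[R]_d}) :
    Prop :=
  forall T : {fset 'rV[R]_d}, (T `<=` S)%fset -> #|` T| = d.+1 ->
    ~ exists2 H : set 'rV[R]_d, hyperplane H & forall x, x \in T -> H x.

(* The convex hull of the vertices v 0, ..., v k.  Affine independence is not
   required here: it is automatic for d + 1 distinct points of a set in general
   position in R^d. *)
Definition closed_simplex (R : realType) (d k : nat)
    (v : 'I_k.+1 -> 'rV[R]_d) : set 'rV[R]_d :=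
  [set x | exists w : 'I_k.+1 -> R,
    [/\ forall i, 0 <= w i, \sum_i w i = 1 & x = \sum_i w i *: v i]].

(* Main.v *)
Require Import Defs.
From HB Require Import structures.
From mathcomp Require Import boolp classical_sets reals exp.
From mathcomp Require Import topology normedtype derive.
From mathcomp Require Import all_boot all_order all_algebra finmap.
From mathcomp Require Import lra ring zify.

Import Order.TTheory GRing.Theory Num.Theory.

Set Implicit Arguments.
Unset Strict Implicit.
Unset Printing Implicit Defensive.

Local Open Scope ring_scope.

(**
Write D = d + 1.  An affine map sends R^d onto the hyperplane of R^D on which
the coordinates sum to 1, and all the given points inside the open standard
simplex; simplices of R^d become simplicial cones of R^D.  The proof then has
two halves.

Selection.  Some point x lies in a fraction at least 1 / (2 D!) of the rainbow
simplices (those with one vertex of each colour); this is rainbow_selection.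
It is a discrete form of a topological argument of Karasev.  Suppose that
every point is hit by fewer rainbow simplices.  Subdivide the standard simplex
into tiny simplices.  To every face u of the subdivision attach an apex, the
opposite of a point of colour dim u, chosen so that few simplices on the later
colours are hit by the cone over what has been built on u; together with its
coned off faces a simplex s becomes a cycle, closing s.  In top dimension so
few points of the last colour are hit that one of them is missed, and a cycle
that misses a point covers a generic point z an even number of times
(coneb_closing, from even_facets).  Summing over the subdivision, all the cones
over interior faces cancel modulo 2, and the cones over boundary faces do not
meet the interior; but the tiny simplices themselves cover z exactly as often
as the standard simplex does, which is once modulo 2.  Tininess is needed
because then a simplex of dimension at least 1 is hit by few tuples: by
compactness the simplices that hit it could be moved to a common point
(family_gap), and general position bounds the number of simplices of
dimension less than d through a point (card_in_tail_cone).

Density to completeness.  By Cramer's rule the tuples whose simplex contains x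
are the solutions of D inequalities, up to a global sign, that are linear in
each of the D points separately.  For such a system complete_subfamily turns
density 1 / e into sets S_i with all transversals solutions, one colour after
the other.  The step for one colour is cutting_lemma: a random sample of the
remaining tuples defines an arrangement of hyperplanes; its cells are
triangulated into few cones, and a union bound over the possible cones shows
that some sample makes every cone of the triangulation uncut by most of the
other tuples.  A popular cone contains many points of the current colour, and
these points may be replaced by the at most D generators of the cone, because
the inequalities are linear in this point.  Since the generators number at
most D per colour, the later steps involve D^(O(D)) inequalities, so each step
costs a factor D^(O(D^2)), which is 2^(O(d^2 log(d+1))).

When n is below this factor a single point in each P_i suffices.
*)

(** * Lists of simplices modulo 2 *)

Section Chains.
Variable V : eqType.
Implicit Types (s t : seq V) (T : seq (seq V)) (Phi : seq V -> bool).

(** Simplices are lists of vertices in a fixed order and chains modulo 2 are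
    lists of simplices, evaluated only through the parity of a predicate; the
    identity d d = 0 then holds on the nose and no quotient is needed. *)
Fixpoint faces s : seq (seq V) :=
  if s is x :: s' then s' :: map (cons x) (faces s') else [::].

Definition parity Phi T : bool := \big[addb/false]_(t <- T) Phi t.

Definition cobound Phi s : bool := parity Phi (faces s).

Lemma parity_nil Phi : parity Phi [::] = false.
Proof. by rewrite /parity big_nil. Qed.

Lemma parity_cons Phi s T : parity Phi (s :: T) = Phi s (+) parity Phi T.
Proof. by rewrite /parity big_cons. Qed.

Lemma parity_flatten Phi (TT : seq (seq (seq V))) :
  parity Phi (flatten TT) = \big[addb/false]_(T <- TT) parity Phi T.
Proof.
elim: TT => [|T TT IH]; first by rewrite big_nil parity_nil.
by rewrite big_cons -IH /parity /= big_cat.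
Qed.

Lemma parity_map Phi x T : parity Phi (map (cons x) T) = parity (fun s => Phi (x :: s)) T.
Proof. by rewrite /parity big_map. Qed.

Lemma eq_parity Phi Psi T : {in T, Phi =1 Psi} -> parity Phi T = parity Psi T.
Proof. by move=> e; rewrite /parity big_seq_cond [RHS]big_seq_cond; apply: eq_bigr => i /andP[/e]. Qed.

Lemma parityD Phi Psi T : parity (fun s => Phi s (+) Psi s) T = parity Phi T (+) parity Psi T.
Proof. by rewrite /parity big_split. Qed.

Lemma parity0 T : parity (fun=> false) T = false.
Proof. by rewrite /parity big1. Qed.

Lemma cobound_cons Phi x s :
  cobound Phi (x :: s) = Phi s (+) cobound (fun t => Phi (x :: t)) s.
Proof. by rewrite /cobound /= parity_cons parity_map. Qed.

Lemma cobound_cobound Phi s : cobound (cobound Phi) s = false.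
Proof.
elim: s Phi => [|x s IH] Phi; first by rewrite /cobound parity_nil.
rewrite cobound_cons {2}/cobound.
under eq_parity => t _ do rewrite cobound_cons.
by rewrite parityD -/(cobound _ _) -/(cobound (cobound _) _) IH addbF addbb.
Qed.

Lemma size_faces s u : u \in faces s -> size s = (size u).+1.
Proof.
elim: s u => //= x s IH u; rewrite inE => /orP[/eqP-> //|/mapP[t /IH -> ->]] //.
Qed.

Lemma mem_faces s u : u \in faces s -> {subset u <= s}.
Proof.
elim: s u => //= x s IH u; rewrite inE => /orP[/eqP->|/mapP[t /IH ts ->]] y.
  by rewrite inE => ->; rewrite orbT.
by rewrite !inE => /orP[->//|/ts->]; rewrite orbT.
Qed.

(** [closing s] is [s] together with a cone over [closing u] for each facet
    [u] of [s].  Its boundary vanishes modulo 2 whatever the apexes are; the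
    rule that chooses the apex over [u] may look at [closing u]. *)
Section Closing.
Variable pick_apex : seq V -> seq (seq V) -> V.

Fixpoint closing_rec m s : seq (seq V) :=
  if m is m'.+1 then
    s :: flatten [seq map (cons (pick_apex u (closing_rec m' u))) (closing_rec m' u) | u <- faces s]
  else [:: s].

Definition closing s := closing_rec (size s) s.
Definition apex s := pick_apex s (closing s).

Lemma closingE s :
  closing s = s :: flatten [seq map (cons (apex u)) (closing u) | u <- faces s].
Proof.
case: s => [//|x s]; rewrite /closing; set l := x :: s.
have -> : closing_rec (size l) l = l :: flatten
  [seq map (cons (pick_apex u (closing_rec (size s) u))) (closing_rec (size s) u) | u <- faces l] by [].
congr (l :: flatten _); apply/eq_in_map => u /size_faces [e].
by rewrite /apex /closing e.
Qed.

Lemma parity_closing Phi s :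
  parity Phi (closing s) = Phi s (+) cobound (fun u => parity (fun t => Phi (apex u :: t)) (closing u)) s.
Proof.
rewrite closingE parity_cons parity_flatten /cobound {2}/parity big_map; congr (_ (+) _).
by apply: eq_bigr => u _; rewrite parity_map.
Qed.

(** The boundary of the cone over a cycle is that cycle.  So the boundary of
    [closing s] consists of the facets of [s] and of the cycles [closing u], in
    which [u] cancels the facet and the rest is the coned off boundary of the
    boundary of [s]. *)
Lemma closing_cycle Phi s : parity (cobound Phi) (closing s) = false.
Proof.
elim: {s}(size s) {-2}s (leqnn (size s)) Phi => [|m IH] s sm Phi.
  by move: sm; rewrite leqn0 => /nilP->; rewrite parity_closing /cobound !parity_nil.
rewrite parity_closing.
have -> : cobound (fun u => parity (fun t => cobound Phi (apex u :: t)) (closing u)) s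
   = cobound (fun u => parity Phi (closing u)) s.
  apply: eq_parity => u /size_faces us.
  under eq_parity => t _ do rewrite cobound_cons.
  rewrite parityD IH ?addbF //; lia.
have -> : cobound (fun u => parity Phi (closing u)) s = cobound Phi s (+)
    cobound (cobound (fun u => parity (fun t => Phi (apex u :: t)) (closing u))) s.
  rewrite -parityD; apply: eq_parity => u _; exact: parity_closing.
by rewrite cobound_cobound addbF addbb.
Qed.

Lemma size_closing s t : t \in closing s -> size t = size s.
Proof.
elim: {s}(size s) {-2}s (leqnn (size s)) t => [|m IH] s sm t.
  by move: sm; rewrite leqn0 => /nilP->; rewrite closingE /= inE => /eqP ->.
rewrite closingE inE => /orP[/eqP->//|/flatten_mapP[u us /mapP[t' t'u ->]]] /=.
have us' := size_faces us; rewrite (IH u) // ?us' //; lia.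
Qed.

Lemma closing_sub (A : pred V) s : (forall u, {subset u <= s} -> A (apex u)) -> {subset s <= A} ->
  forall t, t \in closing s -> {subset t <= A}.
Proof.
elim: {s}(size s) {-2}s (leqnn (size s)) => [|m IH] s sm hA sA t.
  by move: sm; rewrite leqn0 => /nilP->; rewrite closingE /= inE => /eqP ->.
rewrite closingE inE => /orP[/eqP->//|/flatten_mapP[u us /mapP[t' t'u ->]]] y.
have us' := size_faces us; have uss := mem_faces us.
rewrite inE => /orP[/eqP->|]; first by apply: hA.
apply: (IH u) t'u y; first by lia.
  by move=> w wu; apply: hA => y /wu /uss.
by move=> y /uss /sA.
Qed.

End Closing.

(** Subdivision by coning the subdivided facets from a point; [bary] is
    arbitrary here because the chain level identities hold for any choice. *)
Section Subdiv.
Variable bary : seq V -> V.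
Fixpoint sd_rec m s : seq (seq V) :=
  if m is m'.+1 then flatten [seq map (cons (bary s)) (sd_rec m' u) | u <- faces s]
  else [:: [::]].
Definition sd s := sd_rec (size s) s.

Lemma sd_nil : sd [::] = [:: [::]]. Proof. by []. Qed.

Lemma sdE x s : sd (x :: s) =
  flatten [seq map (cons (bary (x :: s))) (sd u) | u <- faces (x :: s)].
Proof.
rewrite /sd; set l := x :: s.
have -> : sd_rec (size l) l = flatten
  [seq map (cons (bary l)) (sd_rec (size s) u) | u <- faces l] by [].
congr (flatten _).
by apply/eq_in_map => u /size_faces [e]; rewrite e.
Qed.

Lemma parity_sd Phi x s : let l := x :: s in
  parity Phi (sd l) = cobound (fun u => parity (fun t => Phi (bary l :: t)) (sd u)) l.
Proof.
rewrite /= sdE parity_flatten /cobound /parity big_map.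
by apply: eq_bigr => u _; rewrite -/(parity _ _) parity_map.
Qed.

Lemma sd_cobound Phi s : parity (cobound Phi) (sd s) = cobound (fun u => parity Phi (sd u)) s.
Proof.
elim: {s}(size s) {-2}s (leqnn (size s)) Phi => [|m IH] s sm Phi.
  by move: sm; rewrite leqn0 => /nilP->; rewrite sd_nil parity_cons /cobound !parity_nil.
case: s sm => [|x s] sm; first by rewrite sd_nil parity_cons /cobound !parity_nil.
rewrite parity_sd.
transitivity (cobound (fun u => parity Phi (sd u) (+)
    cobound (fun w => parity (fun t => Phi (bary (x :: s) :: t)) (sd w)) u) (x :: s)).
  apply: eq_parity => u /size_faces us.
  under eq_parity => t _ do rewrite cobound_cons.
  by rewrite parityD IH //; move: sm us => /=; lia.
by rewrite {1}/cobound parityD -/(cobound (cobound _) _) cobound_cobound addbF.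
Qed.

Lemma size_sd s t : t \in sd s -> size t = size s.
Proof.
elim: {s}(size s) {-2}s (leqnn (size s)) t => [|m IH] s sm t.
  by move: sm; rewrite leqn0 => /nilP->; rewrite /= inE => /eqP ->.
case: s sm => [|x s] sm; first by rewrite /= inE => /eqP ->.
rewrite sdE => /flatten_mapP[u us /mapP[t' t'u ->]] /=.
have us' := size_faces us; rewrite (IH u) //; move: sm us' => /=; lia.
Qed.

Lemma sd_sub (A : pred V) s :
  (forall u, u != [::] -> {subset u <= A} -> A (bary u)) -> {subset s <= A} ->
  forall t, t \in sd s -> {subset t <= A}.
Proof.
move=> hA; elim: {s}(size s) {-2}s (leqnn (size s)) => [|m IH] s sm sA t.
  by move: sm; rewrite leqn0 => /nilP->; rewrite /= inE => /eqP ->.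
case: s sm sA => [|x s] sm sA; first by rewrite /= inE => /eqP ->.
rewrite sdE => /flatten_mapP[u us /mapP[t' t'u ->]] y.
have us' := size_faces us; have uss := mem_faces us.
rewrite inE => /orP[/eqP->|]; first by apply: hA.
by apply: (IH u) t'u y; [move: us' sm => /=; lia|move=> y /uss /sA].
Qed.

Definition sdall T := flatten (map sd T).

Lemma parity_sdall Phi T : parity Phi (sdall T) = parity (fun s => parity Phi (sd s)) T.
Proof. by rewrite parity_flatten /parity big_map. Qed.

(** In particular [T] and [U] may be a simplex and its facets: the iterated
    subdivision of a simplex has the subdivided facets as its boundary. *)
Lemma sdall_cobound T U : (forall Phi, parity (cobound Phi) T = parity Phi U) ->
  forall m Phi, parity (cobound Phi) (iter m sdall T) = parity Phi (iter m sdall U).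
Proof.
move=> h; elim=> [//|m IH] Phi.
rewrite !iterS !parity_sdall -IH; apply: eq_parity => s _; exact: sd_cobound.
Qed.

Lemma size_sdall D T m : (forall s, s \in T -> size s = D) ->
  forall t, t \in iter m sdall T -> size t = D.
Proof.
move=> hT; elim: m => [//|m IH] t; rewrite iterS => /flatten_mapP[s sT ts].
by rewrite (size_sd ts) IH.
Qed.

End Subdiv.
End Chains.

(** * Cones spanned by lists of vectors *)

Section Cones.
Variables (R : realFieldType) (D : nat).
Local Notation V := 'rV[R]_D.
Implicit Types (a b : nat -> R) (s u l : seq V) (x z : V).

Definition lincomb a s : V := \sum_(i < size s) a i *: s`_i.

Lemma lincomb_cons a x s :
  lincomb a (x :: s) = a 0%N *: x + lincomb (fun i => a i.+1) s.
Proof. by rewrite /lincomb /= big_ord_recl. Qed.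

Lemma lincomb_nil a : lincomb a [::] = 0.
Proof. by rewrite /lincomb big_ord0. Qed.

Lemma lincombD a b s : lincomb (fun i => a i + b i) s = lincomb a s + lincomb b s.
Proof. by rewrite -big_split; apply: eq_bigr => i _; rewrite scalerDl. Qed.

Lemma lincombZ c a s : lincomb (fun i => c * a i) s = c *: lincomb a s.
Proof. by rewrite /lincomb scaler_sumr; apply: eq_bigr => i _; rewrite scalerA. Qed.

Lemma lincombB a b s : lincomb (fun i => a i - b i) s = lincomb a s - lincomb b s.
Proof. by rewrite -[X in _ = _ + X]scaleN1r -lincombZ -lincombD; congr lincomb; apply: funext => i; rewrite mulN1r. Qed.

Lemma eq_lincomb a b s : (forall i, (i < size s)%N -> a i = b i) -> lincomb a s = lincomb b s.
Proof. by move=> e; apply: eq_bigr => i _; rewrite e. Qed.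

(** Coefficients are functions on [nat], of which only the first [size s]
    values matter; this keeps sums over lists free of dependent types. *)
Definition incone s z := exists2 a, (forall i, 0 <= a i) & z = lincomb a s.
Definition inspan s z := exists a, z = lincomb a s.

Fixpoint del (i : nat) s : seq V :=
  match s, i with
  | x :: s', 0%N => s'
  | x :: s', i'.+1 => x :: del i' s'
  | [::], _ => [::]
  end.

Lemma facesE s : faces s = [seq del i s | i <- iota 0 (size s)].
Proof.
elim: s => //= x s ->; congr (_ :: _).
by rewrite -map_comp (iotaDl 1 0) -map_comp.
Qed.

Lemma lincomb_del a i s : a i = 0 ->
  lincomb (fun k => a (bump i k)) (del i s) = lincomb a s.
Proof.
elim: s i a => [|x s IH] [|i] a a0 //=; rewrite ?lincomb_nil //.
  by rewrite lincomb_cons a0 scale0r add0r.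
rewrite !lincomb_cons -(IH i (fun k => a k.+1)) //; congr (_ + _).
by apply: eq_lincomb => k _; rewrite /bump ltnS addnS.
Qed.

Lemma lincomb_undel b i s :
  lincomb b (del i s) = lincomb (fun k => if k == i then 0 else b (unbump i k)) s.
Proof.
rewrite -(@lincomb_del _ i s) ?eqxx //; apply: eq_lincomb => k _.
by rewrite eq_sym (negbTE (neq_bump i k)) // bumpK.
Qed.

Lemma incone_del i s z :
  incone (del i s) z <-> exists a, [/\ forall k, 0 <= a k, a i = 0 & z = lincomb a s].
Proof.
split=> [[b b0 ->]|[a [a0 ai ->]]].
  exists (fun k => if k == i then 0 else b (unbump i k)).
  split; rewrite ?eqxx ?lincomb_undel // => k; by case: ifP.
by exists (fun k => a (bump i k)) => [k|]; rewrite ?lincomb_del.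
Qed.

Lemma mem_del i s : {subset del i s <= s}.
Proof.
elim: s i => [|x s IH] [|i] //= y; rewrite ?inE; first by move=> ->; rewrite orbT.
by case/orP=> [->//|/IH->]; rewrite orbT.
Qed.

Lemma size_del i s : (i < size s)%N -> (size (del i s)).+1 = size s.
Proof. by elim: s i => [|x s IH] [|i] //= h; rewrite IH. Qed.

Lemma inspan_del2 i j a s : (i < size s)%N -> (j < size s)%N -> i != j ->
  a i = 0 -> a j = 0 ->
  exists u, [/\ {subset u <= s}, (size u).+2 = size s & inspan u (lincomb a s)].
Proof.
wlog ij : i j / (i < j)%N.
  move=> h hi hj; rewrite neq_ltn => /orP[] ij ai aj; [apply: (h i j)|apply: (h j i)] => //.
    by rewrite neq_ltn ij.
  by rewrite neq_ltn ij.
move=> hi hj _ ai aj; exists (del i (del j s)); split.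
- by move=> y /mem_del /mem_del.
- have e := size_del hj; have h : (i < size (del j s))%N by rewrite -ltnS e (leq_ltn_trans ij).
  by rewrite (size_del h).
exists (fun k => a (bump j (bump i k))).
rewrite (@lincomb_del (fun k => a (bump j k)) i) ?lincomb_del //.
by rewrite /bump leqNgt ij.
Qed.

(** More than [D] vectors are dependent: a tall matrix has a nonzero left
    kernel. *)
Lemma exists_dependency s : (D < size s)%N ->
  exists2 a, lincomb a s = 0 & exists2 i, (i < size s)%N & a i != 0.
Proof.
move=> Ds; pose A : 'M[R]_(size s, D) := \matrix_(i < size s) s`_i.
have : kermx A != 0.
  rewrite -mxrank_eq0 mxrank_ker -lt0n subn_gt0; exact: leq_ltn_trans (rank_leq_col A) Ds.
case/rowV0Pn => v /sub_kermxP vA /rV0Pn[i vi].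
pose a k := if insub k is Some i then v 0 i else 0.
have aE (j : 'I_(size s)) : a j = v 0 j by rewrite /a valK.
exists a; last by exists i; rewrite ?aE.
rewrite -vA mulmx_sum_row; apply: eq_bigr => j _.
by rewrite aE rowK.
Qed.

Definition coneb z s := `[< incone s z >].

(** Avoiding the spans of fewer than [D] vectors also keeps [z] out of every
    degenerate cone on [D] vectors. *)
Definition generic z (K : {pred V}) :=
  forall u, {subset u <= K} -> (size u < D)%N -> ~ inspan u z.

(** No nontrivial nonnegative combination vanishes; besides pointedness of
    the cone this asks that no vector of the list be zero. *)
Definition pointed s := forall a, (forall i, 0 <= a i) -> lincomb a s = 0 ->
  forall i, (i < size s)%N -> a i = 0.

Lemma argmin_nat (n : nat) (P : pred nat) (r : nat -> R) :
  (exists2 i, (i < n)%N & P i) ->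
  exists i, [/\ (i < n)%N, P i & forall j, (j < n)%N -> P j -> r i <= r j].
Proof.
case=> i0 i0n Pi0.
pose Q := [pred i : 'I_n | P i].
case: (arg_minP (fun i : 'I_n => r i) (P := Q) (i0 := Ordinal i0n)) => // i Pi imin.
by exists i; split=> // j jn Pj; apply: (imin (Ordinal jn)).
Qed.

Section Even.
Variables (l : seq V) (z : V).
Hypotheses (sl : size l = D.+1) (pl : pointed l) (gz : generic z [in l]).

Let two_zeros a i j : z = lincomb a l -> (i < size l)%N -> (j < size l)%N ->
  a i = 0 -> a j = 0 -> i = j.
Proof.
move=> za hi hj ai aj; case: (eqVneq i j) => // ij.
have [u [ul su zu]] := inspan_del2 hi hj ij ai aj.
by case: (gz ul); [move: su; rewrite sl => -[]; lia | rewrite za].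
Qed.

Let two_zeros_ord a (i j : 'I_(size l)) : z = lincomb a l ->
  a i = 0 -> a j = 0 -> i = j.
Proof. by move=> za; move/(two_zeros za (ltn_ord i) (ltn_ord j)) => h /h /val_inj. Qed.

(** Moving from one representation along a dependency, some coefficient is
   the first to reach zero. *)
Let move_ a b : (forall i, 0 <= a i) -> z = lincomb a l -> lincomb b l = 0 ->
  (exists2 i, (i < size l)%N & b i < 0) ->
  exists j t, [/\ (j < size l)%N, b j < 0, 0 <= t, a j + t * b j = 0 &
    forall i, (i < size l)%N -> 0 <= a i + t * b i].
Proof.
move=> a0 za b0 bneg.
have [j [hj bj jmin]] := @argmin_nat _ (fun i => b i < 0) (fun i => a i / - b i) bneg.
exists j, (a j / - b j); split=> //.
- by rewrite divr_ge0 // oppr_ge0 ltW.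
- by rewrite invrN mulrN mulNr divfK ?subrr // lt_eqF.
move=> i hi; case: (ltP (b i) 0) => bi; last first.
  by rewrite addr_ge0 // mulr_ge0 // divr_ge0 // oppr_ge0 ltW.
by have := jmin i hi bi; rewrite ler_pdivlMr ?oppr_gt0 // mulrN lerNl -subr_ge0 opprK addrC.
Qed.

Let dep_neg b : lincomb b l = 0 -> (exists2 i, (i < size l)%N & 0 < b i) ->
  exists2 i, (i < size l)%N & b i < 0.
Proof.
move=> b0 [i hi bi]; apply: contrapT => /forall2NP hn.
have bp k : (k < size l)%N -> 0 <= b k by move=> hk; case: (hn k) => // /negP; rewrite -leNgt.
pose b' k := if (k < size l)%N then b k else 0.
have : b' i = 0.
  apply: pl => [k| |//]; first by rewrite /b'; case: ifP => // /bp.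
  by rewrite -b0; apply: eq_lincomb => k hk; rewrite /b' hk.
by rewrite /b' hi; lra.
Qed.

(** At an end of the segment, a dependency that fixes the vanishing coefficient
   would lead to a second vanishing coefficient; hence the space of
   dependencies is at most one dimensional. *)
Let dep0 a b i : (forall i, 0 <= a i) -> z = lincomb a l -> (i < size l)%N -> a i = 0 ->
  lincomb b l = 0 -> b i = 0 -> forall k, (k < size l)%N -> b k = 0.
Proof.
move=> a0 za hi ai.
have main b' : lincomb b' l = 0 -> b' i = 0 -> forall k, (k < size l)%N -> b' k <= 0.
  move=> b0 bi k hk; rewrite leNgt; apply/negP => bk.
  have [|j [t [hj bj t0 e h]]] := move_ a0 za b0; first by apply: dep_neg => //; exists k.
  have := two_zeros (a := fun i => a i + t * b' i) _ hj hi e.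
  rewrite ai bi mulr0 addr0 => ji.
  suff /eqP : j = i by move=> /eqP jE; move: bj; rewrite jE bi ltxx.
  by apply: ji => //; rewrite lincombD lincombZ b0 scaler0 addr0.
move=> b0 bi k hk; apply/eqP; rewrite eq_le main //=.
have := main (fun i => -1 * b i); rewrite lincombZ b0 scaler0 => /(_ erefl).
by rewrite bi mulr0 => /(_ erefl k hk); rewrite mulN1r oppr_le0.
Qed.

(** The nonnegative representations of [z] on [D + 1] vectors form a polytope
    of dimension at most one, which is bounded as the list is pointed: a
    segment or nothing.  A facet whose cone contains [z] is an end of the
    segment, and an end belongs to a single facet as [z] is generic. *)
Lemma even_facets : cobound (coneb z) l = false.
Proof.
have il : iota 0 (size l) = index_iota 0 (size l) by rewrite /index_iota subn0.
rewrite /cobound facesE /parity big_map il big_mkord.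
have [/existsP[i /asboolP/incone_del[a [a0 ai za]]]|] :=
  boolP [exists i : 'I_(size l), coneb z (del i l)]; last first.
  by rewrite negb_exists => /forallP h; rewrite big1 // => i _; apply/negbTE.
have [b0 b0l [k hk bk]] : exists2 b, lincomb b l = 0 & exists2 i, (i < size l)%N & b i != 0.
  by apply: exists_dependency; rewrite sl.
(* Facet [i] covers [z]: follow the dependency from this end of the segment
   to the other one, at facet [j]. *)
have b0i : b0 i != 0.
  by apply: contra_neq bk => bi; apply: (dep0 (a := a)) bi _ _.
pose b k := b0 i * b0 k.
have bl : lincomb b l = 0 by rewrite lincombZ b0l scaler0.
have bi : 0 < b i by rewrite /b -expr2 exprn_even_gt0.
have [|j [t [hj bj t0 e h]]] := move_ a0 za bl.
  by apply: dep_neg => //; exists i.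
pose a' k := if (k < size l)%N then a k + t * b k else 0.
have a'0 k' : 0 <= a' k' by rewrite /a'; case: ifP => // /h.
have za' : z = lincomb a' l.
  rewrite -[LHS]addr0 -(scaler0 _ t) -bl -lincombZ {1}za -lincombD.
  by apply: eq_lincomb => k' hk'; rewrite /a' hk'.
have a'j : a' j = 0 by rewrite /a' hj.
have ij : Ordinal hj != i by apply: contraTneq bj => /(congr1 val) /= ->; rewrite -leNgt ltW.
(* A third end [c] would lie on the line through the two ends [a] and [a']. *)
have uniq (m : 'I_(size l)) : m != i -> m != Ordinal hj -> coneb z (del m l) = false.
  move=> mi mj; apply/negbTE/negP => /asboolP/incone_del[c [c0 cm zc]].
  pose d1 k := c k - a k; pose d2 k := a' k - a k.
  have e1 : lincomb d1 l = 0 by rewrite lincombB -zc -za subrr.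
  have e2 : lincomb d2 l = 0 by rewrite lincombB -za' -za subrr.
  have prop k' : (k' < size l)%N -> d2 i * d1 k' - d1 i * d2 k' = 0.
    apply: (dep0 (a := a) (b := fun k' => d2 i * d1 k' - d1 i * d2 k') (i := i)) => //.
      by rewrite lincombB !lincombZ e1 e2 !scaler0 subrr.
    by rewrite mulrC subrr.
  have ci : 0 < c i.
    rewrite lt_def c0 andbT; apply: contra_neq mi => cz.
    by apply: two_zeros_ord zc _ _.
  have a'i : 0 < a' i.
    rewrite lt_def a'0 andbT; apply: contra_neq ij => cz.
    by apply: two_zeros_ord za' _ _.
  have am : 0 < a m.
    rewrite lt_def a0 andbT; apply: contra_neq mi => cz.
    by apply: two_zeros_ord za _ _.
  have aj : 0 < a j.
    rewrite lt_def a0 andbT; apply: contra_neq ij => cz.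
    by apply: two_zeros_ord za _ _.
  have a'm : 0 < a' m.
    rewrite lt_def a'0 andbT; apply: contra_neq mj => cz.
    by apply: two_zeros_ord za' _ _.
  have := prop j hj; have := prop m (ltn_ord m).
  rewrite /d1 /d2 a'j cm ai !subr0 !add0r => p1 p2.
    have cj := c0 j.
  have ci_le : c i <= a' i.
    rewrite -(ler_pM2r aj); have : 0 <= a' i * c j by rewrite mulr_ge0 // ltW.
    by move: p2; rewrite mulrBr; clear; lra.
  have : 0 < c i * a' m by rewrite mulr_gt0.
  have : c i * a m <= a' i * a m by rewrite ler_wpM2r // ltW.
  by move: p1; rewrite mulrBr mulrN; clear; lra.
rewrite (bigD1 i) //= (bigD1 (Ordinal hj)) //= [X in _ (+) (_ (+) X)]big1 ?addbF.
  have -> : coneb z (del i l) by apply/asboolP/incone_del; exists a.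
  by have -> : coneb z (del j l) by apply/asboolP/incone_del; exists a'.
by move=> m /andP[mi mj]; exact: uniq.
Qed.
End Even.

End Cones.

(** * Barycentric subdivision and generic points *)

Lemma cobound_cat (V : eqType) (Phi : seq V -> bool) s t :
  cobound Phi (s ++ t) = cobound (fun u => Phi (u ++ t)) s (+) cobound (fun u => Phi (s ++ u)) t.
Proof.
elim: s Phi => [|x s IH] Phi; first by rewrite [X in X (+) _]/cobound parity_nil.
by rewrite /= !cobound_cons IH addbA.
Qed.

Section Geometry.
Variables (R : realFieldType) (D : nat).
Local Notation V := 'rV[R]_D.
Implicit Types (s u t l : seq V) (x y z : V).

Lemma lincomb_cat (a : nat -> R) s t :
  lincomb a (s ++ t) = lincomb a s + lincomb (fun i => a (size s + i)%N) t.
Proof.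
elim: s a => [|x s IH] a; first by rewrite lincomb_nil add0r.
by rewrite /= !lincomb_cons IH addrA.
Qed.

Definition bary s : V := (size s)%:R^-1 *: \sum_(x <- s) x.

Lemma baryE s : bary s = lincomb (fun=> (size s)%:R^-1) s.
Proof. by rewrite /lincomb -scaler_sumr /bary (big_nth 0) big_mkord. Qed.

Lemma bary1 x : bary [:: x] = x.
Proof. by rewrite /bary big_seq1 invr1 scale1r. Qed.

(** The points of the affine space are the vectors with [hgt x = 1]. *)
Definition hgt x : R := \sum_j x 0 j.

Lemma hgtD x y : hgt (x + y) = hgt x + hgt y.
Proof. by rewrite -big_split; apply: eq_bigr => j _; rewrite mxE. Qed.
Lemma hgtZ c x : hgt (c *: x) = c * hgt x.
Proof. by rewrite /hgt mulr_sumr; apply: eq_bigr => j _; rewrite mxE. Qed.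
Lemma hgt0 : hgt 0 = 0. Proof. by rewrite /hgt big1 // => j _; rewrite mxE. Qed.
Lemma hgt_sum (I : Type) (r : seq I) (P : pred I) (F : I -> V) :
  hgt (\sum_(i <- r | P i) F i) = \sum_(i <- r | P i) hgt (F i).
Proof. exact: (big_morph hgt hgtD hgt0). Qed.

Definition affpt : {pred V} := fun x => hgt x == 1.

Lemma hgt_lincomb (a : nat -> R) s : {subset s <= affpt} ->
  hgt (lincomb a s) = \sum_(i < size s) a i.
Proof.
move=> sA; rewrite hgt_sum; apply: eq_bigr => i _; rewrite hgtZ.
by have /eqP -> : affpt s`_i; [apply: sA; rewrite mem_nth|rewrite mulr1].
Qed.

Lemma pointed_aff s : {subset s <= affpt} -> pointed s.
Proof.
move=> sA a a0 /(congr1 hgt); rewrite hgt0 hgt_lincomb // => /psumr_eq0P.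
by move=> h i hi; apply: (h _ (Ordinal hi)).
Qed.

Lemma bary_aff s : s != [::] -> {subset s <= affpt} -> affpt (bary s).
Proof.
move=> s0 sA; apply/eqP; rewrite baryE hgt_lincomb // sumr_const card_ord.
by rewrite -[LHS]mulr_natr mulVf // pnatr_eq0 size_eq0.
Qed.

Lemma inspan_bary w s z : inspan (w ++ bary s :: s) z -> inspan (w ++ s) z.
Proof.
case=> a ->; rewrite lincomb_cat lincomb_cons baryE -lincombZ -lincombD.
set c := fun i => _ + _.
exists (fun i => if (i < size w)%N then a i else c (i - size w)%N).
rewrite lincomb_cat; congr (_ + _); apply: eq_lincomb => i h; rewrite ?h //.
by rewrite ltnNge leq_addr addKn.
Qed.

Lemma incone_inspan s z : incone s z -> inspan s z.
Proof. by case=> a _ ->; exists a. Qed.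

(** Invariance of the covering parity of a generic point under subdivision.
    The vertices in [B] are carried along by the induction on [s].  Applying
    [even_facets] to the list [B ++ b :: s], with [b] the barycentre of [s],
    the facets that drop a vertex of [B] keep both [b] and [s], hence are
    degenerate and do not cover [z]; the others express the coning of the
    facets of [s] from [b]. *)
Lemma coneb_sd_prefix (K : {pred V}) z B s :
  generic z K -> {subset K <= affpt} -> (size B + size s = D)%N ->
  {subset B <= K} ->
  (forall u, u != [::] -> (size u <= size s)%N -> {subset u <= s} -> bary u \in K) ->
  parity (fun t => coneb z (B ++ t)) (sd bary s) = coneb z (B ++ s).
Proof.
move=> gK KA; elim: {s}(size s) {-2}s (leqnn (size s)) B => [|m IH] s sm B sD BK sK.
  by move: sm; rewrite leqn0 => /nilP->; rewrite sd_nil parity_cons parity_nil addbF.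
case: s sm sD sK => [|x s] sm sD sK; first by rewrite sd_nil parity_cons parity_nil addbF.
set l := x :: s in sm sD sK *; set b := bary l.
have lK : {subset l <= K}.
  by move=> y yl; rewrite -(bary1 y); apply: sK => // w; rewrite inE => /eqP->.
have bK : b \in K by apply: sK.
have sub w t : {subset w <= K} -> {subset t <= K} -> {subset w ++ t <= K}.
  by move=> wK tK y; rewrite mem_cat => /orP[/wK|/tK].
have subc y t : y \in K -> {subset t <= K} -> {subset y :: t <= K}.
  by move=> yK tK w; rewrite inE => /orP[/eqP->|/tK].
rewrite parity_sd -/l.
have -> : cobound (fun u => parity (fun t => coneb z (B ++ bary l :: t)) (sd bary u)) l =
  cobound (fun u => coneb z (B ++ b :: u)) l.
  apply: eq_parity => u ul; have us := size_faces ul.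
  under eq_parity => t _ do rewrite -/b -cat_rcons.
  rewrite IH ?cat_rcons //.
  - by move: sm; rewrite us.
  - by move: sD; rewrite size_rcons us addSnnS.
  - by move=> y; rewrite mem_rcons => /subc; apply.
  - move=> w w0 wu wsub; apply: sK => //; first by rewrite us ltnW.
    by move=> y /wsub /(mem_faces ul).
have := @even_facets R D (B ++ b :: l) z.
rewrite cobound_cat cobound_cons; set c1 := cobound _ B; set c2 := coneb _ _; set c3 := cobound _ l.
have -> : c1 = false.
  rewrite /c1 /cobound (eq_parity (Psi := fun=> false)) ?parity0 // => w wB.
  have ws := size_faces wB.
  apply/negbTE/negP => /asboolP/incone_inspan/inspan_bary.
  apply: gK; last by rewrite size_cat; apply: eq_leq; move: sD; rewrite ws addSn.
  by apply: sub => // y /(mem_faces wB) /BK.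
move=> h; have /h : size (B ++ b :: l) = D.+1 by rewrite size_cat /= addnS sD.
have bl : {subset B ++ b :: l <= K} by apply: sub => //; apply: subc.
move=> {}h; have : c2 (+) c3 = false.
  by rewrite -[LHS]addFb h // => [|u ul]; [apply: pointed_aff => y /bl /KA|apply: gK => y /ul /bl].
by case: (c2); case: (c3).
Qed.

(** A point of the moment curve [t |-> (1, t, t^2, ...)] will do: each proper
    subspace contains finitely many of its points, as the roots of a nonzero
    polynomial. *)
Lemma exists_generic (L : seq (seq V)) : (0 < D)%N ->
  exists z : V, (forall j, 0 < z 0 j) /\
   forall u, u \in L -> (size u < D)%N -> ~ inspan u z.
Proof.
move=> D0; pose mom (t : R) : V := \row_j t ^+ j.
have [p p0 hp] : exists2 p : {poly R}, p != 0 & forall t : R, ~~ root p t ->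
    forall u, u \in L -> (size u < D)%N -> ~ inspan u (mom t).
  elim: L => [|u L [p p0 IH]]; first by exists 1; rewrite ?oner_eq0.
  case: (ltnP (size u) D) => uD; last first.
    exists p => // t pt w; rewrite inE => /orP[/eqP-> |]; last exact: IH.
    by rewrite ltnNge uD.
  pose A : 'M[R]_(size u, D) := \matrix_(i < size u) u`_i.
  have : kermx A^T != 0.
    rewrite -mxrank_eq0 mxrank_ker -lt0n subn_gt0; exact: leq_ltn_trans (rank_leq_col _) uD.
  case/rowV0Pn => v /sub_kermxP vA v0.
  pose q := \poly_(i < D) (if insub i is Some j then v 0 j else 0).
  have qE (j : 'I_D) : q`_j = v 0 j by rewrite coef_poly ltn_ord valK.
  have q0 : q != 0.
    apply: contra_neq v0 => q0; apply/rowP => j.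
    by rewrite -qE q0 coef0 mxE.
  exists (q * p); first by rewrite mulf_neq0.
  move=> t; rewrite rootM negb_or => /andP[qt pt] w.
  rewrite inE => /orP[/eqP-> _|]; last exact: IH.
  case=> a ma; move/negP: qt; apply; rewrite /root horner_poly.
  have -> : \sum_(i < D) (if insub (val i) is Some j then v 0 j else 0) * t ^+ i =
     (mom t *m v^T) 0 0.
    by rewrite mxE; apply: eq_bigr => j _; rewrite valK !mxE mulrC.
  suff -> : mom t *m v^T = 0 by rewrite mxE.
  rewrite ma /lincomb mulmx_suml big1 // => i _.
  rewrite -scalemxAl -(rowK (fun i : 'I_(size u) => u`_i)) -row_mul.
  suff -> : A *m v^T = 0 by rewrite row0 scaler0.
  by apply: trmx_inj; rewrite trmx_mul trmxK vA trmx0.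
have [k pk] : exists k : nat, ~~ root p k.+1%:R.
  apply: contrapT => /forallNP h.
  have := max_poly_roots (rs := [seq k.+1%:R | k <- iota 0 (size p)]) p0.
  rewrite size_map size_iota ltnn => /(_ _ _)/Bool.diff_false_true; apply.
    by apply/allP => _ /mapP[k _ ->]; have := h k; case: root.
  rewrite map_inj_uniq ?iota_uniq // => i j /eqP; rewrite eqr_nat => /eqP [] //.
exists (mom k.+1%:R); split; last exact: hp.
by move=> j; rewrite mxE exprn_gt0.
Qed.

Fixpoint allseqs (n : nat) (K : seq V) : seq (seq V) :=
  if n is n'.+1 then [::] :: [seq x :: s | x <- K, s <- allseqs n' K] else [:: [::]].

Lemma mem_allseqs n K u : {subset u <= K} -> (size u <= n)%N -> u \in allseqs n K.
Proof.
elim: n u => [|n IH] [|x u] uK //= un.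
rewrite inE; apply/orP; right; apply/allpairsP; exists (x, u); split=> //=.
  by apply: uK; rewrite mem_head.
by apply: IH => // y yu; apply: uK; rewrite inE yu orbT.
Qed.

Lemma allseqs_sub n K u : u \in allseqs n K -> {subset u <= K}.
Proof.
elim: n u => [|n IH] u; first by rewrite inE => /eqP->.
rewrite inE => /orP[/eqP-> //|/allpairsP[[x w] /= [xK wK ->]]] v.
by rewrite inE => /orP[/eqP-> //|/(IH _ wK)].
Qed.

(** A finite set containing [K] and all the vertices that one subdivision of
    simplices on [K] can create; genericity is asked with respect to it. *)
Definition addbary (K : seq V) := K ++ [seq bary u | u <- allseqs D K & u != [::]].

Lemma addbary_aff K : {subset K <= affpt} -> {subset addbary K <= affpt}.
Proof.
move=> KA y; rewrite mem_cat => /orP[/KA//|/mapP[u]]; rewrite mem_filter.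
case/andP=> u0 uK ->; apply: bary_aff => // v /(allseqs_sub uK).
exact: KA.
Qed.

Lemma mem_addbary K u : {subset u <= K} -> u != [::] -> (size u <= D)%N ->
  bary u \in addbary K.
Proof.
move=> uK u0 su; rewrite mem_cat; apply/orP; right; apply/mapP; exists u => //.
by rewrite mem_filter u0 mem_allseqs.
Qed.

Lemma coneb_sdall (K : seq V) z s m :
  {subset K <= affpt} -> {subset s <= K} -> size s = D ->
  generic z [in iter m addbary K] ->
  parity (coneb z) (iter m (sdall bary) [:: s]) = coneb z s /\
  (forall t, t \in iter m (sdall bary) [:: s] -> {subset t <= iter m addbary K}).
Proof.
move=> KA sK sD; elim: m => [|m IH] gz.
  split=> [|t /=]; first by rewrite /= parity_cons parity_nil addbF.
  by rewrite inE => /eqP ->.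
have KmA : {subset iter m addbary K <= affpt} by elim: m {IH gz} => //= m IH; apply: addbary_aff.
have [|IH1 IH2] := IH.
  by move=> u uK; apply: gz => y /uK yK; apply: (_ : y \in _ ++ _); rewrite mem_cat; apply/orP; left.
split; last first.
  move=> t; rewrite !iterS => /flatten_mapP[w wT tw].
  have ws : size w = D by apply: size_sdall wT => w'; rewrite inE => /eqP->.
  have wK := IH2 w wT.
  suff h n v : (size v <= n)%N -> (n <= D)%N -> {subset v <= iter m addbary K} ->
    forall t, t \in sd bary v -> {subset t <= addbary (iter m addbary K)}.
    by apply: (h D w) => //; rewrite ws.
  elim: n v => [|n IHn] [|x v] vn nD vK t'; rewrite ?inE; try by move=> /eqP->.
    by [].
  rewrite sdE => /flatten_mapP[u us /mapP[t'' t'u ->]] y.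
  have us' := size_faces us; have uss := mem_faces us.
  rewrite inE => /orP[/eqP->|]; first by apply: mem_addbary => //; apply: leq_trans vn nD.
  apply: (IHn u) t'u y; [by move: us' vn => /= [<-]|exact: ltnW|by move=> y /uss /vK].
rewrite iterS parity_sdall -IH1; apply: eq_parity => t tT.
have ts : size t = D by apply: size_sdall tT => w'; rewrite inE => /eqP->.
apply: (@coneb_sd_prefix [in iter m.+1 addbary K] z [::] t) => //.
  exact: addbary_aff.
move=> u u0 uts ut; apply: (@mem_addbary (iter m addbary K)) => //; last first.
  by apply: leq_trans uts _; apply: eq_leq.
by move=> y /ut /(IH2 _ tT).
Qed.

Definition within (e : R) s := forall x y, x \in s -> y \in s -> forall j, `|x 0 j - y 0 j| <= e.

Lemma bary_coord s j : (bary s) 0 j = (size s)%:R^-1 * \sum_(x <- s) x 0 j.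
Proof. by rewrite mxE summxE. Qed.

Lemma sum_const_seq (T : Type) (r : seq T) (c : R) : \sum_(x <- r) c = (size r)%:R * c.
Proof. by rewrite big_const_seq count_predT iter_addr_0 -[LHS]mulr_natl. Qed.

Lemma bary_dist s y (e : R) j : s != [::] -> (forall x, x \in s -> `|x 0 j - y 0 j| <= e) ->
  `|(bary s) 0 j - y 0 j| <= e.
Proof.
move=> s0 h.
have sp : 0 < (size s)%:R :> R by rewrite ltr0n lt0n size_eq0.
have -> : (bary s) 0 j - y 0 j = (size s)%:R^-1 * \sum_(x <- s) (x 0 j - y 0 j).
  by rewrite bary_coord sumrB mulrBr sum_const_seq mulKf // gt_eqF.
rewrite normrM gtr0_norm ?invr_gt0 // ler_pdivrMl //.
apply: le_trans (ler_norm_sum _ _ _) _; rewrite big_seq.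
apply: le_trans (ler_sum _ (fun x xs => h x xs)) _.
by rewrite -big_seq sum_const_seq.
Qed.

(** One of the terms of the average of [y - x] over the vertices [y] is zero,
    which gives the contraction factor. *)
Lemma bary_dist_vertex s x (e : R) j : x \in s -> (size s <= D)%N ->
  0 <= e -> within e s -> `|(bary s) 0 j - x 0 j| <= (1 - D%:R^-1) * e.
Proof.
move=> xs sD e0 ns.
have s0 : (0 < size s)%N by case: s xs {sD ns}.
have sp : 0 < (size s)%:R :> R by rewrite ltr0n.
have -> : (bary s) 0 j - x 0 j = (size s)%:R^-1 * \sum_(y <- s) (y 0 j - x 0 j).
  by rewrite bary_coord sumrB mulrBr sum_const_seq mulKf // gt_eqF.
rewrite (perm_big _ (perm_to_rem xs)) /= big_cons subrr add0r.
rewrite normrM gtr0_norm ?invr_gt0 //.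
have -> : size s = (size (rem x s)).+1 by rewrite size_rem // prednK.
have h : `|\sum_(y <- rem x s) (y 0 j - x 0 j)| <= (size (rem x s))%:R * e.
  apply: le_trans (ler_norm_sum _ _ _) _; rewrite big_seq.
  apply: le_trans (ler_sum _ (fun y ys => ns y x (mem_rem ys) xs j)) _.
  by rewrite -big_seq sum_const_seq.
apply: le_trans (ler_wpM2l _ h) _; first by rewrite invr_ge0.
rewrite mulrA ler_wpM2r //; set k := size _.
have kD : (k.+1 <= D)%N by rewrite /k size_rem // prednK.
have -> : k.+1%:R^-1 * k%:R = 1 - k.+1%:R^-1 :> R.
  by rewrite -[k%:R](addrK 1) natr1 mulrBr mulVf ?pnatr_eq0 // mulr1.
rewrite lerD2l lerN2 lef_pV2 ?posrE ?ltr0n ?ler_nat //; exact: leq_trans kD.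
Qed.

Lemma sd_within s (e : R) : (size s <= D)%N -> 0 <= e -> within e s ->
  forall t, t \in sd bary s -> within ((1 - D%:R^-1) * e) t.
Proof.
move=> sD e0; elim: {s}(size s) {-2}s (leqnn (size s)) sD => [|m IH] s sm sD ns t.
  by move: sm; rewrite leqn0 => /nilP->; rewrite /= inE => /eqP ->.
case: s sm sD ns => [|x s] sm sD ns; first by rewrite /= inE => /eqP ->.
set l := x :: s in sm sD ns *.
rewrite sdE => /flatten_mapP[u us /mapP[t' t'u ->]]; rewrite -/l.
have us' := size_faces us; have uss := mem_faces us.
have t'n : within ((1 - D%:R^-1) * e) t'.
  apply: (IH u) t'u; [by move: us' sm => /= [<-]|by rewrite -ltnS -us' ltnW|].
  by move=> y w /uss yl /uss wl; apply: ns.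
pose A : {pred 'rV[R]_D} := fun y => [forall j, `|(bary l) 0 j - y 0 j| <= (1 - D%:R^-1) * e].
have c0 : 0 <= (1 - D%:R^-1) * e.
  rewrite mulr_ge0 // subr_ge0 invf_le1 ?ler1n ?ltr0n; exact: leq_trans sD.
have tA : {subset t' <= A}.
  apply: (sd_sub (A := A)) t'u => [w w0 wA|y /uss yl].
    apply/forallP => j; rewrite distrC; apply: bary_dist => // y /wA /forallP /(_ j).
    by rewrite distrC.
  by apply/forallP => j; apply: bary_dist_vertex.
move=> y w; rewrite !inE => /orP[/eqP->|yt] /orP[/eqP->|wt] j.
- by rewrite subrr normr0.
- by have /forallP := tA _ wt; apply.
- by have /forallP/(_ j) := tA _ yt; rewrite distrC.
- exact: t'n.
Qed.

Lemma sdall_within T m (e : R) : 0 <= e -> (forall s, s \in T -> size s = D /\ within e s) ->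
  forall t, t \in iter m (sdall bary) T -> within ((1 - D%:R^-1) ^+ m * e) t.
Proof.
move=> e0 hT; elim: m => [|m IH] t; first by rewrite expr0 mul1r => /hT[].
move=> tT; move: (tT); rewrite iterS => /flatten_mapP[s sT ts].
have ss : size s = D by apply: size_sdall sT => s' /hT[].
rewrite exprS -mulrA; apply: sd_within ts; rewrite ?ss //; last exact: IH.
case: (posnP D) => [->|D0]; first by rewrite invr0 subr0 expr1n mul1r.
by rewrite mulr_ge0 // exprn_ge0 // subr_ge0 invf_le1 ?ler1n ?ltr0n.
Qed.

End Geometry.

(** * Closing simplices by far away cones *)

Section Update.
Variables (I A : finType).
Definition upd (f : {ffun I -> A}) (j : I) (a : A) : {ffun I -> A} :=
  [ffun i => if i == j then a else f i].

Lemma upd_eq f j a : upd f j a j = a. Proof. by rewrite ffunE eqxx. Qed.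
Lemma upd_neq f j a i : i != j -> upd f j a i = f i.
Proof. by rewrite ffunE => /negbTE ->. Qed.
Lemma updK f j a : upd (upd f j a) j (f j) = f.
Proof. by apply/ffunP => i; rewrite !ffunE; case: eqP => // ->. Qed.

(** Averaging over one coordinate: resampling coordinate [j] of a uniformly
    distributed [f] does not change its distribution. *)
Lemma sum_upd (F : {ffun I -> A} -> nat) (j : I) :
  (\sum_f \sum_a F (upd f j a) = #|A| * \sum_f F f)%N.
Proof.
pose h (p : {ffun I -> A} * A) := (upd p.1 j p.2, p.1 j).
have hK : cancel h h by case=> f a; rewrite /h /= updK upd_eq.
rewrite pair_big /= (reindex_inj (can_inj hK)) /=.
under eq_bigr => p _ do rewrite updK.
rewrite -(pair_big xpredT xpredT (fun f (_ : A) => F f)) /= exchange_big /=.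
by rewrite sum_nat_const.
Qed.
End Update.

Section Selection.
Variables (R : realFieldType) (d n : nat).
Local Notation D := d.+1.
Local Notation V := 'rV[R]_D.
Variables (pt : 'I_D -> 'I_n -> V) (a0 : 'I_n).
Hypothesis pt_pos : forall i a j, 0 < pt i a 0 j.
Hypothesis pt_aff : forall i a, affpt (pt i a).
Local Notation tup := {ffun 'I_D -> 'I_n}.

(** The cone on [s] meets the cone on the points of colours at least [k]
    selected by [f].  The nonvanishing is asked of the coefficients on [s], not
    of the common vector, so that a list admitting a nonnegative dependency is
    hit by every [f]; lists that are not hit are therefore pointed. *)
Definition hit (k : nat) (f : tup) (s : seq V) : Prop :=
  exists (a : nat -> R) (b : 'I_D -> R), [/\ forall i, 0 <= a i, forall j, 0 <= b j,
    exists2 i, (i < size s)%N & a i != 0 &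
    lincomb a s = \sum_(j : 'I_D | (k <= j)%N) b j *: pt j (f j)].

(** Whole tuples are counted although only the colours at least [k] matter,
    which normalizes all the counts by [n ^ D]. *)
Definition hit_count k (T : seq (seq V)) :=
  #|[set f : tup | has (fun s => `[< hit k f s >]) T]|.

Lemma hit_countE k T : hit_count k T = (\sum_(f : tup) has (fun s => `[< hit k f s >]) T)%N.
Proof. by rewrite /hit_count -sum1_card big_mkcond /=; apply: eq_bigr => f _; rewrite inE; case: has. Qed.

Lemma hit_count_nil k : hit_count k [::] = 0%N.
Proof. by rewrite hit_countE big1. Qed.

Lemma hit_count_cons k s T : (hit_count k (s :: T) <= hit_count k [:: s] + hit_count k T)%N.
Proof.
rewrite !hit_countE -big_split /=; apply: leq_sum => f _; rewrite orbF.
by case: asbool; case: has.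
Qed.

Lemma hit_count_flatten k (TT : seq (seq (seq V))) (m : nat) :
  (forall T, T \in TT -> hit_count k T <= m)%N -> (hit_count k (flatten TT) <= size TT * m)%N.
Proof.
elim: TT => [|T TT IH] h; first by rewrite hit_count_nil.
have -> : (size (T :: TT) * m = m + size TT * m)%N by rewrite mulSn.
have le1 : (hit_count k (T ++ flatten TT) <= hit_count k T + hit_count k (flatten TT))%N.
  rewrite !hit_countE -big_split /=; apply: leq_sum => f _; rewrite has_cat.
  by case: has; case: has.
apply: leq_trans le1 _; rewrite leq_add ?h ?mem_head // IH // => T' hT'.
by rewrite h // inE hT' orbT.
Qed.

(** A cone with apex opposite to [p] meets a simplex only if its base meets
    the join of this simplex with [p]. *)
Lemma hit_cone k (kD : (k < D)%N) f a s :
  hit k.+1 f (- pt (inord k) a :: s) -> hit k (upd f (inord k) a) s.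
Proof.
case=> al [b [al0 b0 [i hi ai]]]; rewrite lincomb_cons scalerN => e.
have {}e : lincomb (fun i => al i.+1) s =
   al 0%N *: pt (inord k) a + \sum_(j : 'I_D | (k < j)%N) b j *: pt j (f j).
  by rewrite -e addrA subrr add0r.
exists (fun i => al i.+1), (fun j : 'I_D => if j == k :> nat then al 0%N else b j).
split=> // [j| |]; first by case: ifP.
  case: i hi ai => [_ a0n|i si ai]; last by exists i.
  apply: contrapT => /forall2NP hs.
  have l0 : lincomb (fun i => al i.+1) s = 0.
    rewrite /lincomb big1 // => j _; have [h|/negP] := hs j; first by case: h.
    by rewrite negbK => /eqP ->; rewrite scale0r.
  move/(congr1 (@hgt R D)): e; rewrite l0 hgt0 hgtD hgtZ (eqP (pt_aff _ _)) mulr1 hgt_sum => e.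
  move: a0n; rewrite (_ : al 0%N = 0) ?eqxx //.
  have : 0 <= \sum_(j : 'I_D | (k < j)%N) hgt (b j *: pt j (f j)).
    by apply: sumr_ge0 => j _; rewrite hgtZ (eqP (pt_aff _ _)) mulr1.
  have := al0 0%N; move: e; clear; lra.
rewrite e [RHS](bigD1 (inord k)) /=; last by rewrite inordK.
rewrite inordK // eqxx upd_eq; congr (_ + _).
apply: eq_big => [j|j kj].
  by rewrite ltn_neqAle andbC -val_eqE /= inordK // [(j : nat) == k]eq_sym.
have jk : j != inord k by rewrite -val_eqE /= inordK // gtn_eqF.
by rewrite gtn_eqF // upd_neq.
Qed.

(** The apex over the empty face.  All its coordinates are negative, so no
    combination of the given points meets it. *)
Definition anchor : V := - const_mx 1.

(** The point of colour [k] whose cone over [Z] is hit least. *)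
Definition best k (Z : seq (seq V)) : V :=
  - pt (inord k) [arg min_(a < a0) hit_count k.+1 (map (cons (- pt (inord k) a)) Z)].

Definition apex_rule (u : seq V) Z := if u is [::] then anchor else best (size u).-1 Z.

(** By [hit_cone] the average over the points of colour [k] of the number of
    tuples hitting the cone is at most the number hitting the base. *)
Lemma hit_count_best k Z : (k < D)%N ->
  (hit_count k.+1 (map (cons (best k Z)) Z) <= hit_count k Z)%N.
Proof.
move=> kD; rewrite /best; case: arg_minnP => // a _ amin.
have n0 : (0 < n)%N by case: (n) a0 => // -[].
rewrite -(leq_pmul2l n0).
apply: (@leq_trans (\sum_(b < n) hit_count k.+1 (map (cons (- pt (inord k) b)) Z))%N).
  rewrite -{1}(card_ord n) -sum_nat_const; apply: leq_sum => b _; exact: amin.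
under eq_bigr => b _ do rewrite hit_countE.
rewrite exchange_big /= hit_countE -[n in (_ <= n * _)%N]card_ord -(sum_upd _ (inord k)).
apply: leq_sum => f _; apply: leq_sum => b _.
have [/hasP[_ /mapP[s sZ ->] /asboolP h]|//] := boolP (has _ (map _ _)).
suff -> : has (fun s => `[< hit k (upd f (inord k) b) s >]) Z by [].
by apply/hasP; exists s => //; apply/asboolP; apply: hit_cone h.
Qed.

Lemma hit_count_anchor k : hit_count k [:: [:: anchor]] = 0%N.
Proof.
rewrite hit_countE big1 // => f _ /=; rewrite orbF; case: asboolP => // -[a [b [a0' b0 [[|//] _ an0]]]].
rewrite lincomb_cons lincomb_nil addr0 => /rowP/(_ 0).
rewrite summxE !mxE => e.
have : 0 <= \sum_(j : 'I_D | (k <= j)%N) (b j *: pt j (f j)) 0 0.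
  by apply: sumr_ge0 => j _; rewrite mxE mulr_ge0 // ltW.
rewrite -e mulrN1 oppr_ge0 => h; case/negP: an0; rewrite eq_le h; exact: a0'.
Qed.

Local Notation closing := (closing apex_rule).
Local Notation apex := (apex apex_rule).

(** The tuples hitting the closing of a simplex of dimension [k] are those
    hitting the simplex and those hitting the closings of its [k + 1] facets. *)
Fixpoint hit_factor k := if k is k'.+1 then (1 + k.+1 * hit_factor k')%N else 1%N.

Lemma hit_factor_le k : ((hit_factor k).+1 <= 2 * k.+1`!)%N.
Proof.
elim: k => [//|k IH] /=; rewrite factS.
have /leq_trans : (hit_factor k <= 2 * k.+1`! - 1)%N by lia.
have := fact_gt0 k.+1; set F := k.+1`! in IH *; move: IH; nia.
Qed.

Variables (e : R) (c : nat).
Definition small_affine (s : seq V) := {subset s <= @affpt R D} /\ within e s.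
Hypothesis hit_count_pt : forall x, affpt x -> (hit_count 0 [:: [:: x]] <= c)%N.
Hypothesis hit_count_small : forall s : seq V, small_affine s -> (1 < size s <= D)%N ->
  (hit_count (size s).-1 [:: s] <= c)%N.

Lemma small_affine_face s u : small_affine s -> u \in faces s -> small_affine u.
Proof.
move=> [sA sn] /mem_faces us; split; first by move=> x /us /sA.
by move=> x y /us xs /us ys; apply: sn.
Qed.

Lemma hit_count_closing k s : small_affine s -> size s = k.+1 -> (k < D)%N ->
  (hit_count k (closing s) <= hit_factor k * c)%N.
Proof.
elim: k s => [|k IH] s sms ss kD.
  case: s ss sms => [//|x [|//]] _ [sA _]; rewrite closingE (_ : flatten _ = [:: [:: anchor]]) //.
  apply: leq_trans (hit_count_cons _ _ _) _; rewrite hit_count_anchor addn0 mul1n.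
  by apply/hit_count_pt/sA; rewrite mem_head.
rewrite closingE; apply: leq_trans (hit_count_cons _ _ _) _.
rewrite [hit_factor _.+1]/= mulnDl mul1n leq_add //.
  by have := hit_count_small sms; rewrite ss; apply.
rewrite -mulnA -ss.
have -> : size s = size [seq [seq apex u :: i | i <- closing u] | u <- faces s].
  by rewrite size_map facesE size_map size_iota.
apply: hit_count_flatten => _ /mapP[u us ->].
have su : size u = k.+1 by have := size_faces us; rewrite ss => -[].
have -> : apex u = best k (closing u).
  by rewrite /apex /apex_rule su; case: (u) su.
apply: leq_trans (hit_count_best _ _) _; first exact: ltnW.
by apply: IH => //; [apply: small_affine_face us|apply: ltnW].
Qed.

Hypothesis c_lt : (2 * D`! * c <= n ^ D)%N.

(** With all hits bounded by [c], fewer than [n ^ D] tuples hit the closing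
    of a simplex of full dimension. *)
Lemma exists_unhit s : small_affine s -> size s = D ->
  exists f : tup, forall t, t \in closing s -> ~ hit d f t.
Proof.
move=> sms ss.
have n0 : (0 < n)%N by case: (n) a0 => // -[].
have : (hit_count d (closing s) < #|{: tup}|)%N.
  apply: leq_ltn_trans (hit_count_closing sms ss (ltnSn d)) _.
  rewrite card_ffun !card_ord; have := hit_factor_le d.
  case: (posnP c) => [->|c0 h]; first by rewrite muln0 expn_gt0 n0.
  by apply: leq_trans c_lt; apply: leq_trans (leq_mul h (leqnn c)); rewrite ltn_pmul2r.
case: (pickP (fun f : tup => ~~ has (fun s => `[< hit d f s >]) (closing s))) => [f /hasPn h _|h].
  by exists f => t /h /asboolP.
rewrite /hit_count (_ : [set f | _] = setT) ?cardsT ?ltnn //.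
by apply/setP => f; rewrite !inE; have := h f; case: has.
Qed.

Definition closing_support (K : seq V) : {pred V} := fun x =>
  [|| x \in K, x == anchor | [exists i, [exists a, x == - pt i a]]].

Lemma apex_in_support K u : closing_support K (apex u).
Proof.
rewrite /closing_support /apex /apex_rule; case: u => [|x u]; first by rewrite eqxx orbT.
apply/orP; right; apply/orP; right; apply/existsP; eexists; apply/existsP; eexists.
by rewrite /best.
Qed.

Lemma closing_in_support K s t : {subset s <= K} -> t \in closing s -> {subset t <= closing_support K}.
Proof.
move=> sK; apply: closing_sub => [u _|x /sK xK]; first exact: apex_in_support.
by rewrite unfold_in /closing_support xK.
Qed.

(** Let [p] be a point of the last colour that no simplex of the closing
    contains.  By [even_facets] applied to [- p :: t], covering of [z] by the
    members [t] of the closing is the coboundary of covering by the cones from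
    [- p], so it sums to zero over a cycle. *)
Lemma coneb_closing (K : seq V) z s : small_affine s -> size s = D -> {subset s <= K} ->
  generic z (closing_support K) -> parity (coneb z) (closing s) = false.
Proof.
move=> sms ss sK gz; have [f hf] := exists_unhit sms ss.
pose p := pt ord_max (f ord_max).
rewrite -(closing_cycle apex_rule (fun t => coneb z (- p :: t)) s).
apply: eq_parity => t ts.
have st : size t = D by rewrite (size_closing ts).
have tK := closing_in_support sK ts.
have := @even_facets R D (- p :: t) z; rewrite cobound_cons => h.
have {}h : coneb z t (+) cobound (fun t => coneb z (- p :: t)) t = false.
  apply: h => /=; first by rewrite st.
    move=> a a0' e0.
    have ai0 i : (i < size t)%N -> a i.+1 = 0.
      move=> it; apply/eqP; apply: contrapT => /negP ai; apply: (hf t ts).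
      exists (fun i => a i.+1), (fun j => if j == ord_max then a 0%N else 0); split=> //.
      - by move=> j; case: ifP.
      - by exists i.
      rewrite (bigD1 ord_max) //= eqxx big1 ?addr0 => [|j /andP[_ /negbTE ->]]; last by rewrite scale0r.
      by apply/eqP; rewrite -subr_eq0 addrC -scalerN -lincomb_cons e0.
    case=> [_|i]; last exact: ai0.
    move: e0; rewrite lincomb_cons.
    rewrite [X in _ + X](_ : _ = 0) ?addr0; last first.
      by rewrite /lincomb big1 // => i _; rewrite ai0 // scale0r.
    move/(congr1 (@hgt R D)); rewrite scalerN -scaleNr hgtZ hgt0 (eqP (pt_aff _ _)) mulr1.
    by move/eqP; rewrite oppr_eq0 => /eqP.
  move=> u ut; apply: gz => x /ut; rewrite inE => /orP[/eqP->|/tK //].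
  rewrite unfold_in /closing_support; apply/orP; right; apply/orP; right.
  by apply/existsP; exists ord_max; apply/existsP; exists (f ord_max).
by move: h; case: coneb; case: cobound.
Qed.

Definition std_simplex : seq V := [seq delta_mx 0 j | j <- enum 'I_D].

Lemma size_std_simplex : size std_simplex = D. Proof. by rewrite size_map size_enum_ord. Qed.

Lemma std_simplex_aff : {subset std_simplex <= @affpt R D}.
Proof.
move=> _ /mapP[j _ ->]; rewrite unfold_in /affpt /hgt (bigD1 j) //= big1 ?addr0.
  by rewrite mxE !eqxx.
by move=> i /negbTE ij; rewrite mxE ij andbF.
Qed.

Lemma nth_std_simplex (j : 'I_D) : std_simplex`_j = delta_mx 0 j.
Proof. by rewrite (nth_map ord0) ?size_enum_ord // nth_ord_enum. Qed.

Lemma coneb_std_simplex (z : V) : (forall j, 0 < z 0 j) -> coneb z std_simplex.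
Proof.
move=> z0; apply/asboolP.
exists (fun i => if insub i is Some j then z 0 j else 0).
  by move=> i; case: insub => // j; apply: ltW.
pose a i := if insub i is Some j then z 0 j else 0.
rewrite /lincomb -(big_mkord xpredT (fun i => a i *: std_simplex`_i)) size_std_simplex big_mkord.
by rewrite [LHS]row_sum_delta; apply: eq_bigr => j _; rewrite /a valK nth_std_simplex.
Qed.

Lemma faces_std_simplex u : u \in faces std_simplex -> exists i : 'I_D, forall x, x \in u -> x 0 i = 0.
Proof.
rewrite facesE => /mapP[i]; rewrite mem_iota size_std_simplex /= => iD ->.
exists (Ordinal iD).
suff h (s : seq 'I_D) k : uniq s -> (k < size s)%N -> forall x, x \in del k [seq delta_mx 0 j : V | j <- s] ->
    x 0 (nth ord0 s k) = 0.
  have := h (enum 'I_D) i (enum_uniq _); rewrite size_enum_ord => /(_ iD).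
  by rewrite (nth_ord_enum ord0 (Ordinal iD)).
elim: s k => [//|j s IH] [|k] /= /andP[js us] ks x.
  move=> /mapP[j' j's ->]; rewrite mxE eqxx /=.
  by case: eqP => // jj; move: js; rewrite jj j's.
rewrite inE => /orP[/eqP ->|]; last exact: IH.
rewrite mxE eqxx /=; case: eqP => // jj; move: js; rewrite -jj mem_nth //.
Qed.

(** The contradiction: summed over a fine subdivision, closings cover the
    generic point [z] evenly, interior faces cancel, and on a boundary face,
    where some coordinate vanishes, all apexes have that coordinate negative,
    so that what is built on it misses [z], whose coordinates are positive. *)
Lemma no_small_subdivision m :
  (forall t, t \in iter m (sdall (@bary R D)) [:: std_simplex] -> within e t) -> False.
Proof.
move=> hm; pose K := iter m (@addbary R D) std_simplex.
pose K' := K ++ anchor :: [seq - pt i a | i <- enum 'I_D, a <- enum 'I_n].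
have [z [z0 gz]] := exists_generic (allseqs D K') (ltn0Sn d).
have gS : generic z (closing_support K).
  move=> u uK uD; apply: gz => //; apply: mem_allseqs; last exact: ltnW.
  move=> x /uK; rewrite unfold_in /closing_support mem_cat inE => /or3P[->//|->|]; first by rewrite orbT.
  case/existsP=> i /existsP[a /eqP->]; apply/orP; right; apply/orP; right.
  by apply/allpairsP; exists (i, a); rewrite !mem_enum.
have gK : generic z [in K].
  by move=> u uK; apply: gS => x /uK xK; rewrite unfold_in /closing_support; apply/orP; left.
have [E1 TK] := coneb_sdall std_simplex_aff (fun x => id) size_std_simplex gK.
rewrite coneb_std_simplex // in E1.
(* [Psi u] is the parity with which the cone attached to [u] covers [z]. *)
pose Psi u := parity (fun t => coneb z (apex u :: t)) (closing u).
have E2 : parity (coneb z) (iter m (sdall (@bary R D)) [:: std_simplex]) =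
          parity (cobound Psi) (iter m (sdall (@bary R D)) [:: std_simplex]).
  apply: eq_parity => s sT.
  have KA : {subset K <= @affpt R D}.
    by rewrite /K; elim: (m) => [|k IH]; [exact: std_simplex_aff|apply: addbary_aff].
  have := coneb_closing _ _ (TK s sT) gS; rewrite parity_closing -/(cobound Psi s) => h.
  have {}h : coneb z s (+) cobound Psi s = false.
    apply: h; last by apply: size_sdall sT => s'; rewrite inE => /eqP->; rewrite size_std_simplex.
    by split; [move=> x /(TK _ sT) /KA|exact: hm].
  by move: h; case: coneb; case: cobound.
move: E1; rewrite E2 (@sdall_cobound _ _ [:: std_simplex] (faces std_simplex)); last first.
  by move=> Phi; rewrite parity_cons parity_nil addbF.
suff -> : parity Psi (iter m (sdall (@bary R D)) (faces std_simplex)) = false by [].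
rewrite (eq_parity (Psi := fun=> false)) ?parity0 // => u uU.
have {uU} [i iu] : exists i : 'I_D, forall x, x \in u -> x 0 i = 0.
  elim: m u uU {hm K K' gz gS gK TK E2} => [|m IH] u; first exact: faces_std_simplex.
  rewrite iterS => /flatten_mapP[w /IH[i iw] uw]; exists i => x xu.
  pose A : {pred 'rV[R]_D} := fun x => x 0 i == 0.
  apply/eqP; apply: (sd_sub (A := A)) uw x xu => [v v0 vA|x /iw xi]; last by apply/eqP.
  rewrite /A bary_coord big_seq big1 ?mulr0 // => y /vA /eqP //.
rewrite /Psi (eq_parity (Psi := fun=> false)) ?parity0 // => t tu.
have neg_apex w : apex w 0 i <= 0.
  rewrite /apex /apex_rule; case: (w) => [|? ?]; first by rewrite !mxE lerN10.
  by rewrite mxE oppr_le0 ltW.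
pose A : {pred 'rV[R]_D} := fun x => x 0 i <= 0.
have tA : {subset t <= A}.
  apply: (closing_sub (A := A)) tu => [w _|x /iu xi]; first exact: neg_apex.
  by rewrite unfold_in /A xi.
apply/negbTE/negP => /asboolP[a a0' za].
have := z0 i; rewrite ltNge za lincomb_cons /lincomb !mxE summxE => /negP; apply.
rewrite -oppr_ge0 opprD addr_ge0 // oppr_ge0.
  by rewrite mulr_ge0_le0.
by apply: sumr_le0 => j _; rewrite mxE mulr_ge0_le0 //; apply: (tA _ (mem_nth _ _)).
Qed.

End Selection.

(** * A point in many rainbow simplices *)

Section BoxGap.
Import numFieldNormedType.Exports.
Local Open Scope classical_set_scope.
Variables (R : realType) (N : nat).

Lemma continuous_bigsum (I : Type) (r : seq I) (P : pred I) (F : I -> 'rV[R]_N -> R) :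
  (forall i, continuous (F i)) -> continuous (fun v => \sum_(i <- r | P i) F i v).
Proof.
move=> cF; elim: r => [|i r IH].
  by under eq_fun do rewrite big_nil; exact: cst_continuous.
under eq_fun do rewrite big_cons; case: (P i) => //.
by move=> v; apply: continuousD; [exact: cF|exact: IH].
Qed.

Lemma affine_continuous (c : 'I_N -> R) (c0 : R) :
  continuous (fun v : 'rV[R]_N => \sum_i c i * v 0 i + c0).
Proof.
move=> v; apply: continuousD; last exact: cst_continuous.
apply: continuous_bigsum => i w; apply: continuousM; first exact: cst_continuous.
exact: coord_continuous.
Qed.

(** Affine functions without a common zero on a cube are uniformly bounded
    away from a common zero, by compactness of the cube. *)
Lemma box_gap (T : finType) (c : T -> 'I_N -> R) (c0 : T -> R) :
  (forall v : 'I_N -> R, (forall i, 0 <= v i <= 1) ->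
    exists t, \sum_i c t i * v i + c0 t != 0) ->
  exists2 delta : R, 0 < delta &
    forall v : 'I_N -> R, (forall i, 0 <= v i <= 1) ->
    exists t, delta <= `|\sum_i c t i * v i + c0 t|.
Proof.
move=> h0; pose G (v : 'rV[R]_N) := \sum_(t : T) `|\sum_i c t i * v 0 i + c0 t|.
have cG : continuous G.
  apply: continuous_bigsum => t v.
  apply: (@continuous_comp _ _ _ (fun v : 'rV[R]_N => \sum_i c t i * v 0 i + c0 t) Num.norm).
    exact: affine_continuous.
  exact: norm_continuous.
pose A := [set v : 'rV[R]_N | forall i, `[0, 1]%classic (v ord0 i)].
have A0 : A !=set0 by exists 0 => i /=; rewrite mxE in_itv /= lexx ler01.
have cA : compact A.
  by apply: (@rV_compact (R : ptopologicalType) N (fun=> `[0, 1]%classic)) => _; exact: segment_compact.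
have cGA : {within A, continuous G} by apply: continuous_subspaceT.
have [w wA wmin] := EVT_min_rV A0 cA cGA.
have G0 : 0 < G w.
  have [i|t tw] := h0 (fun i => w 0 i).
    by move: wA; rewrite in_setE => /(_ i) /=; rewrite in_itv.
  rewrite /G (bigD1 t) //= ltr_pwDl ?normr_gt0 // sumr_ge0 //.
exists (G w / #|T|.+1%:R); first by rewrite divr_gt0.
move=> v hv; apply: contrapT => /forallNP hn.
have : G w <= G (\row_i v i).
  by apply: wmin; rewrite in_setE => i /=; rewrite mxE in_itv /=; exact: hv.
suff : G (\row_i v i) <= \sum_(t : T) G w / #|T|.+1%:R.
  move=> h1 h2; have := le_trans h2 h1.
  rewrite sumr_const -[X in _ <= X -> _]mulr_natr mulrAC ler_pdivlMr // ler_pM2l // ler_nat ltnn //.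
apply: ler_sum => t _; have -> : \sum_i c t i * (\row_i v i) 0 i = \sum_i c t i * v i.
  by apply: eq_bigr => i _; rewrite mxE.
by have := hn t; move/negP; rewrite -ltNge => /ltW.
Qed.
End BoxGap.

Lemma box_gap_fin (R : realType) (J T : finType) (c : T -> J -> R) (c0 : T -> R) :
  (forall v : J -> R, (forall i, 0 <= v i <= 1) ->
    exists t, \sum_i c t i * v i + c0 t != 0) ->
  exists2 delta : R, 0 < delta &
    forall v : J -> R, (forall i, 0 <= v i <= 1) ->
    exists t, delta <= `|\sum_i c t i * v i + c0 t|.
Proof.
move=> h.
have E t (v : J -> R) : \sum_(i < #|J|) c t (enum_val i) * v (enum_val i) = \sum_i c t i * v i.
  by rewrite [RHS](reindex (enum_val (A := J))) //; exact/onW_bij/enum_val_bij.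
have [v v01|delta d0 hd] := @box_gap R #|J| T (fun t i => c t (enum_val i)) c0.
  have [i|t ht] := h (fun j => v (enum_rank j)); first exact: v01.
  exists t; rewrite -E in ht; under eq_bigr => i _ do rewrite -[v i](congr1 v (enum_valK i)).
  exact: ht.
exists delta => // v v01; have [i|t ht] := hd (fun i => v (enum_val i)); first exact: v01.
by exists t; rewrite E in ht.
Qed.

Lemma common_lower_bound (R : realFieldType) (T : finType) (e : T -> R) :
  (forall t, 0 < e t) -> exists2 e0, 0 < e0 & forall t, e0 <= e t.
Proof.
move=> e_gt0; have s0 (P : pred T) : 0 <= \sum_(t | P t) (e t)^-1.
  by apply: sumr_ge0 => t _; rewrite invr_ge0 ltW.
exists (1 + \sum_t (e t)^-1)^-1; first by rewrite invr_gt0 ltr_pwDl.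
move=> t; rewrite invf_ple ?posrE ?ltr_pwDl ?e_gt0 //.
by rewrite (bigD1 t) //= [leRHS]addrCA lerDl addr_ge0.
Qed.

Lemma bernoulli (R : realFieldType) (x : R) k : 0 <= x -> 1 + k%:R * x <= (1 + x) ^+ k.
Proof.
move=> x0; elim: k => [|k IH]; first by rewrite mul0r addr0 expr0.
rewrite exprS -natr1; have k0 : 0 <= k%:R :> R by [].
have : (1 + x) * (1 + k%:R * x) <= (1 + x) * (1 + x) ^+ k by rewrite ler_wpM2l // addr_ge0.
have : 0 <= k%:R * x * x by rewrite !mulr_ge0.
lra.
Qed.

Lemma dist_lt_of_third (R : realFieldType) (a b w e : R) : 0 < e ->
  `|a - w| <= e / 3 -> `|b - w| <= e / 3 -> `|a - b| < e.
Proof.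
rewrite !ler_norml ltr_norml => e0 /andP[h1 h2] /andP[h3 h4].
by apply/andP; split; lra.
Qed.

Section Small.
Variables (R : realType) (d n : nat).
Local Notation D := d.+1.
Local Notation V := 'rV[R]_D.
Variables (pt : 'I_D -> 'I_n -> V).
Hypothesis pt_pos : forall i a j, 0 < pt i a 0 j.
Hypothesis pt_aff : forall i a, affpt (pt i a).
Hypothesis pt_gp : forall i (U : 'M[R]_D), (\rank U <= d)%N ->
  (#|[set a | (pt i a <= U)%MS]| <= d)%N.
Local Notation tup := {ffun 'I_D -> 'I_n}.

(** The point [y] lies in the simplex on the points of colours at least [k];
    for [y] of height one the coefficients sum to one. *)
Definition in_tail_cone k (y : V) (f : tup) :=
  exists2 b : 'I_D -> R, forall j, 0 <= b j &
    y = \sum_(j : 'I_D | (k <= j)%N) b j *: pt j (f j).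

(** If [j] is the last colour with a positive coefficient, the point of colour
    [j] lies in the span of [y] and of the points of colours [k] to [j - 1].
    This subspace is proper because [k > 0], so it contains at most [d] points
    of colour [j], once the other points are fixed. *)
Lemma card_in_tail_cone k y : (0 < k)%N -> affpt y ->
  (n * #|[set f | `[< in_tail_cone k y f >]]| <= D * d * n ^ D)%N.
Proof.
move=> k0 yA.
(* [k > 0] leaves row 0 for [y], while row [j] vanishes and makes the rank
   at most [d]. *)
pose U (f : tup) (j : 'I_D) : 'M[R]_D := \matrix_(i < D)
  (if i == ord0 then y else if (k <= i < j)%N then pt i (f i) else 0).
have rU f (j : 'I_D) : (0 < j)%N -> (\rank (U f j) <= d)%N.
  move=> j0; rewrite -ltnS -subn_gt0 -mxrank_ker lt0n mxrank_eq0.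
  apply/rowV0Pn; exists (delta_mx 0 j).
    apply/sub_kermxP; rewrite -rowE rowK -val_eqE /= gtn_eqF // ltnn andbF //.
  by apply/negP => /eqP/rowP/(_ j); rewrite !mxE !eqxx => /eqP; rewrite oner_eq0.
pose B (j : 'I_D) := [set f : tup | (0 < j)%N && (pt j (f j) <= U f j)%MS].
have cB j : (n * #|B j| <= d * n ^ D)%N.
  have -> : #|B j| = (\sum_f (f \in B j))%N by rewrite -sum1_card big_mkcond; apply: eq_bigr => f _; case: ifP.
  rewrite -{1}[n]card_ord -(sum_upd (fun f => (f \in B j) : nat) j).
  have -> : (d * n ^ D = \sum_(f : tup) d)%N.
    by rewrite sum_nat_const card_ffun !card_ord mulnC.
  apply: leq_sum => f _.
  case: (posnP j) => [j0|j0].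
    by rewrite big1 // => a _; rewrite inE j0.
  apply: leq_trans (pt_gp j (rU f j j0)).
  rewrite -sum1_card [X in (_ <= X)%N]big_mkcond; apply: leq_sum => a _.
  rewrite !inE upd_eq j0 /= (_ : U (upd f j a) j = U f j); first by case: ifP.
  apply/row_matrixP => i; rewrite !rowK; case: ifP => // _; case: ifP => // /andP[_ ij].
  by rewrite upd_neq // -val_eqE /= ltn_eqF.
have sub : [set f | `[< in_tail_cone k y f >]] \subset \bigcup_j B j.
  apply/subsetP => f; rewrite inE => /asboolP[b b0 yE].
  have [j0 kj0 bj0] : exists2 j : 'I_D, (k <= j)%N & b j != 0.
    apply: contrapT => /forall2NP h; have := yA; rewrite /affpt yE big1 ?hgt0 => [|j kj].
      by rewrite eq_sym oner_eq0.
    by have [//|/negP] := h j; rewrite negbK => /eqP ->; rewrite scale0r.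
  pose P := [pred j : 'I_D | (k <= j)%N && (b j != 0)].
  have Pj0 : P j0 by rewrite /= kj0.
  case: (arg_maxnP (fun j : 'I_D => j : nat) Pj0) => j /= /andP[kj bj] jmax.
  apply/bigcupP; exists j => //; rewrite inE (leq_trans k0 kj) /=.
  have -> : pt j (f j) = (b j)^-1 *: (y - \sum_(i : 'I_D | (k <= i < j)%N) b i *: pt i (f i)).
    rewrite yE (bigID (fun i : 'I_D => i < j)%N) /= addrAC subrr add0r.
    rewrite (bigD1 j) /=; last by rewrite kj -leqNgt leqnn.
    rewrite big1 ?addr0 ?scalerA ?mulVf ?scale1r // => i /andP[/andP[ki ij] ijn].
    suff -> : b i = 0 by rewrite scale0r.
    apply/eqP; apply: contraNT ijn => bi; have := jmax i; rewrite ki bi => /(_ isT).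
    by rewrite -val_eqE /= eqn_leq => ->; rewrite leqNgt.
  have row_le i : (row i (U f j) <= U f j)%MS by exact: row_sub.
  apply: scalemx_sub; apply: addmx_sub.
    by have := row_le ord0; rewrite rowK eqxx.
  rewrite eqmx_opp; apply: summx_sub => i /andP[ki ij]; apply: scalemx_sub.
  have := row_le i; rewrite rowK -val_eqE /= gtn_eqF ?(leq_trans k0) //.
  by rewrite ki ij.
apply: leq_trans (leq_mul (leqnn n) (subset_leq_card sub)) _.
have le : (#|\bigcup_j B j| <= \sum_j #|B j|)%N.
  elim/big_rec2: _ => [|j x y' _ le]; first by rewrite cards0.
  apply: leq_trans (_ : #|B j| + #|y'| <= _)%N; last by rewrite leq_add2l.
  by rewrite cardsU leq_subr.
apply: leq_trans (leq_mul (leqnn n) le) _; rewrite big_distrr /= -mulnA.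
apply: leq_trans (leq_sum _ (fun j _ => cB j)) _.
by rewrite sum_nat_const card_ord.
Qed.

Lemma sum_row_select (W : 'I_D -> R) (v : tup * 'I_D -> R) (f : tup) k :
  \sum_(p : tup * 'I_D) (if (p.1 == f) && (k <= p.2)%N then W p.2 else 0) * v p =
  \sum_(j : 'I_D | (k <= j)%N) W j * v (f, j).
Proof.
transitivity (\sum_(g : tup) \sum_(j < D) (if (g == f) && (k <= j)%N then W j else 0) * v (g, j)).
  by rewrite pair_bigA; apply: eq_bigr => -[].
rewrite (bigD1 f) //= [X in _ + X]big1 ?addr0 => [|g /negbTE gf]; last first.
  by rewrite big1 // => j _; rewrite gf mul0r.
rewrite [RHS]big_mkcond; apply: eq_bigr => j _.
by rewrite eqxx /=; case: ifP => // _; rewrite mul0r.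
Qed.

(** Simplices without a common point cannot all come close to one point.  The
    unknowns of the affine system are the coefficients [v (f, j)] of one point
    in each simplex; the equations say that these are affine coefficients and
    that all these points coincide with that of [f0]. *)
Lemma family_gap k (F : {set tup}) : F != set0 ->
  (forall y, affpt y -> exists2 f, f \in F & ~ in_tail_cone k y f) ->
  exists2 e : R, 0 < e & forall s : seq V, (0 < size s)%N -> {subset s <= @affpt R D} ->
    within e s -> exists2 f, f \in F & ~ hit pt k f s.
Proof.
case/set0Pn => f0 f0F hF.
pose T := (tup + tup * 'I_D)%type.
pose sel (f : tup) (W : 'I_D -> R) (p : tup * 'I_D) := if (p.1 == f) && (k <= p.2)%N then W p.2 else 0.
pose co (f : tup) (i j : 'I_D) : R := pt j (f j) 0 i.
pose c (t : T) (p : tup * 'I_D) : R := match t with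
  | inl f => if f \in F then sel f (fun=> 1) p else 0
  | inr (f, i) => if f \in F then sel f (co f i) p - sel f0 (co f0 i) p else 0
  end.
pose c0 (t : T) : R := if t is inl f then if f \in F then -1 else 0 else 0.
have E1 v f : f \in F -> \sum_p c (inl f) p * v p + c0 (inl f) =
    \sum_(j : 'I_D | (k <= j)%N) v (f, j) - 1.
  move=> fF; rewrite /c /c0 fF sum_row_select; congr (_ - 1).
  by apply: eq_bigr => j _; rewrite mul1r.
have E2 v f i : f \in F -> \sum_p c (inr (f, i)) p * v p + c0 (inr (f, i)) =
    (\sum_(j : 'I_D | (k <= j)%N) v (f, j) *: pt j (f j)) 0 i -
    (\sum_(j : 'I_D | (k <= j)%N) v (f0, j) *: pt j (f0 j)) 0 i.
  move=> fF; rewrite /c /c0 fF addr0.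
  under eq_bigr => p _ do rewrite mulrBl.
  rewrite sumrB !sum_row_select !summxE; congr (_ - _).
    by apply: eq_bigr => j _; rewrite mxE mulrC.
  by apply: eq_bigr => j _; rewrite mxE mulrC.
have [v v01|delta d0 hd] := @box_gap_fin R _ T c c0.
  apply: contrapT => /forallNP hz.
  have {}hz t : \sum_p c t p * v p + c0 t = 0.
    by apply/eqP; have /negP := hz t; rewrite negbK.
  pose y := \sum_(j : 'I_D | (k <= j)%N) v (f0, j) *: pt j (f0 j).
  have yA : affpt y.
    rewrite /affpt hgt_sum; under eq_bigr => j _ do rewrite hgtZ (eqP (pt_aff _ _)) mulr1.
    by rewrite -subr_eq0 -(E1 v f0 f0F) hz.
  have [f fF] := hF y yA; apply; exists (fun j => v (f, j)) => [j|].
    by case/andP: (v01 (f, j)).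
  apply/rowP => i; apply/eqP; rewrite eq_sym -subr_eq0.
  by rewrite -(E2 v f i fF) hz.
exists (delta / 3); first by rewrite divr_gt0.
move=> s s0 sA sn; apply: contrapT => /forall2NP hs.
have /choice[b hb] (f : tup) : exists b : 'I_D -> R, f \in F ->
    [/\ forall j, 0 <= b j, \sum_(j : 'I_D | (k <= j)%N) b j = 1 &
      forall i, `|(\sum_(j : 'I_D | (k <= j)%N) b j *: pt j (f j)) 0 i - s`_0 0 i| <= delta / 3].
  case: (boolP (f \in F)) => fF; last by exists (fun=> 0).
  have [//|/contrapT [a [b [a_ge0 b_ge0 [i0 i0s ai0] e]]]] := hs f.
  pose S := \sum_(i < size s) a i.
  have Sp : 0 < S.
    rewrite /S (bigD1 (Ordinal i0s)) //= ltr_pwDl ?sumr_ge0 //.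
    by rewrite lt_def ai0 /=.
  exists (fun j => b j / S) => _; split=> [j||i].
  - by rewrite divr_ge0 // ltW.
  - rewrite -mulr_suml; apply: (canLR (mulfK (lt0r_neq0 Sp))); rewrite mul1r.
    move/(congr1 (@hgt R D)): e; rewrite hgt_lincomb // hgt_sum -/S => ->.
    by apply: eq_bigr => j _; rewrite hgtZ (eqP (pt_aff _ _)) mulr1.
  have -> : \sum_(j : 'I_D | (k <= j)%N) (b j / S) *: pt j (f j) = S^-1 *: lincomb a s.
    by rewrite e scaler_sumr; apply: eq_bigr => j _; rewrite scalerA mulrC.
  have -> : (S^-1 *: lincomb a s) 0 i - s`_0 0 i = S^-1 * \sum_(j < size s) a j * (s`_j 0 i - s`_0 0 i).
    under [in RHS]eq_bigr => j _ do rewrite mulrBr.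
    rewrite sumrB -mulr_suml -/S mulrBr mulKf ?lt0r_neq0 // mxE summxE; congr (_ * _ - _).
    by apply: eq_bigr => j _; rewrite mxE.
  rewrite normrM gtr0_norm ?invr_gt0 // ler_pdivrMl //.
  apply: le_trans (ler_norm_sum _ _ _) _; rewrite mulr_suml; apply: ler_sum => j _.
  by rewrite normrM ger0_norm // ler_wpM2l //; apply: sn; rewrite mem_nth.
pose v (p : tup * 'I_D) := if (p.1 \in F) && (k <= p.2)%N then b p.1 p.2 else 0.
have vE f (j : 'I_D) : f \in F -> (k <= j)%N -> v (f, j) = b f j by rewrite /v /= => -> ->.
have [p|t] := hd v.
  rewrite /v; case: ifP => [/andP[pF kp]|_]; last by rewrite lexx ler01.
  have [b0 b1 _] := hb _ pF; rewrite b0 /= -b1 (bigD1 p.2) //= lerDl.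
  by apply: sumr_ge0.
apply/negP; rewrite -ltNge; case: t => [f|[f i]].
  case: (boolP (f \in F)) => fF; last first.
    by rewrite /c /c0 (negbTE fF) big1 ?addr0 ?normr0 // => p _; rewrite mul0r.
  rewrite E1 //; under eq_bigr => j kj do rewrite vE //.
  by have [_ -> _] := hb _ fF; rewrite subrr normr0.
case: (boolP (f \in F)) => fF; last first.
  by rewrite /c /c0 (negbTE fF) big1 ?addr0 ?normr0 // => p _; rewrite mul0r.
rewrite E2 //; under eq_bigr => j kj do rewrite vE //.
under [X in _ - fun_of_matrix X _ _]eq_bigr => j kj do rewrite vE //.
have [_ _ /(_ i) h1] := hb _ fF; have [_ _ /(_ i) h2] := hb _ f0F.
exact: dist_lt_of_third h1 h2.
Qed.

Lemma small_simplices_hit_few : exists2 e : R, 0 < e &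
  forall s : seq V, small_affine e s -> (1 < size s <= D)%N ->
   (n * hit_count pt (size s).-1 [:: s] <= D * d * n ^ D)%N.
Proof.
pose big (F : {set tup}) := (D * d * n ^ D < n * #|F|)%N.
have /choice[e he] (p : 'I_D * {set tup}) : exists e : R, 0 < e /\
   ((0 < p.1)%N -> big p.2 -> forall s : seq V, (0 < size s)%N -> {subset s <= @affpt R D} ->
    within e s -> exists2 f, f \in p.2 & ~ hit pt p.1 f s).
  case: p => k F /=; case: (boolP ((0 < k)%N && big F)) => [/andP[k0 bF]|h]; last first.
    by exists 1; split=> // k0 bF; rewrite k0 bF in h.
  have [||e e0 h] := @family_gap k F; last by exists e.
    by apply: contraTneq bF => ->; rewrite /big cards0 muln0.
  move=> y yA; apply: contrapT => /forall2NP h.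
  have := card_in_tail_cone k0 yA; rewrite leqNgt => /negP; apply.
  apply: leq_trans bF _; rewrite leq_mul //; apply: subset_leq_card; apply/subsetP => f fF.
  by rewrite inE; apply/asboolP; have [//|/contrapT] := h f.
have [e0 e0p e0le] := common_lower_bound (fun p => (he p).1).
exists e0 => // s [sA sn] /andP[s1 sD]; rewrite leqNgt; apply/negP => hbig.
have kD : ((size s).-1 < D)%N by rewrite prednK // ltnW.
pose F := [set f : tup | has (fun s => `[< hit pt (size s).-1 f s >]) [:: s]].
have k0 : (0 < (size s).-1)%N by rewrite -ltnS prednK // ltnW.
have sn' : within (e (Ordinal kD, F)) s.
  by move=> x y xs ys j; apply: le_trans (sn x y xs ys j) (e0le _).
have [f] := (he (Ordinal kD, F)).2 k0 hbig s (ltnW s1) sA sn'.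
by rewrite inE /= orbF => /asboolP h /(_ h).
Qed.

(** The hypothesis on [n] makes the bound of [card_in_tail_cone] negligible
    with respect to the number of hits to be found. *)
Lemma rainbow_selection (a0 : 'I_n) : (2 * D`! * (D * d) <= n)%N ->
  exists2 x : V, affpt x & (n ^ D < 2 * D`! * #|[set f | `[< in_tail_cone 0 x f >]]|)%N.
Proof.
move=> hn; pose c := (n ^ D %/ (2 * D`!))%N.
have f0 : (0 < 2 * D`!)%N by rewrite muln_gt0 fact_gt0.
have n0 : (0 < n)%N by case: (n) a0 => // -[].
apply: contrapT => /forall2NP hx.
have [e e0 he] := small_simplices_hit_few.
have hit0 x f : hit pt 0 f [:: x] -> in_tail_cone 0 x f.
  case=> a [b [a_ge0 b_ge0 [[|//] _ an0]]]; rewrite lincomb_cons lincomb_nil addr0 => e1.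
  exists (fun j => (a 0%N)^-1 * b j) => [j|]; first by rewrite mulr_ge0 // invr_ge0.
  by under eq_bigr => j _ do rewrite -scalerA; rewrite -scaler_sumr -e1 scalerA mulVf // scale1r.
have hit_count_pt x : affpt x -> (hit_count pt 0 [:: [:: x]] <= c)%N.
  move=> xA; have [//|/negP] := hx x; rewrite -leqNgt => h.
  rewrite leq_divRL // mulnC; apply: leq_trans h; rewrite leq_mul //.
  apply: subset_leq_card; apply/subsetP => f; rewrite !inE /= orbF => /asboolP h.
  by apply/asboolP/hit0.
have hit_count_sm s : small_affine e s -> (1 < size s <= D)%N -> (hit_count pt (size s).-1 [:: s] <= c)%N.
  move=> sms sD; have := he s sms sD; rewrite expnS mulnCA leq_pmul2l // => h.
  rewrite leq_divRL //; apply: leq_trans (leq_mul h (leqnn _)) _.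
  by rewrite mulnAC expnS leq_mul // mulnC.
have cl : (2 * D`! * c <= n ^ D)%N by rewrite mulnC leq_divM.
(* The mesh shrinks by the factor [q] at each subdivision; when [d > 0],
   Bernoulli's inequality for [q^-1 = 1 + 1 / d] bounds the number of
   subdivisions needed. *)
pose q : R := 1 - D%:R^-1.
have [m hm] : exists m, q ^+ m <= e.
  case: (posnP d) => [d_0|d_gt0].
    by exists 1%N; rewrite /q d_0 invr1 subrr expr0n ltW.
  have q0 : 0 < q by rewrite subr_gt0 invf_lt1 ?ltr1n ?ltr0n.
  have [m hm] : exists m : nat, d%:R / e < m%:R.
    by exists (Num.bound (d%:R / e)); apply: archi_boundP; rewrite divr_ge0 // ltW.
  exists m.
  have qi : q^-1 = 1 + d%:R^-1.
    apply: (mulfI (lt0r_neq0 q0)); rewrite mulfV ?lt0r_neq0 // /q -natr1.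
    have dn : d%:R != 0 :> R by rewrite pnatr_eq0 -lt0n.
    have dn1 : d%:R + 1 != 0 :> R by rewrite natr1 pnatr_eq0.
    by field; rewrite dn dn1.
  have bern : 1 + m%:R / d%:R <= (q^-1) ^+ m by rewrite qi; apply: bernoulli; rewrite invr_ge0.
  rewrite -[q ^+ m]invrK -exprVn invf_ple ?posrE //; last by rewrite exprn_gt0 // invr_gt0.
  apply: le_trans bern; apply: ltW; apply: ltr_wpDl => //.
  by rewrite ltr_pdivlMr ?ltr0n // mulrC.
apply: (@no_small_subdivision R d n pt a0 pt_pos pt_aff e c hit_count_pt hit_count_sm cl m).
move=> t tT x y xt yt j.
have := @sdall_within R D [:: std_simplex R d] m 1 ler01 _ t tT x y xt yt j.
rewrite mulr1 => h; apply: le_trans hm; apply: h => s; rewrite inE => /eqP ->.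
split; first exact: size_std_simplex.
move=> _ _ /mapP[i _ ->] /mapP[i' _ ->] j'; rewrite !mxE eqxx /=.
by case: eqP; case: eqP; rewrite ?subrr ?subr0 ?sub0r ?normrN ?normr0 ?normr1.
Qed.
End Small.

(** * Counting the sign patterns of linear functionals *)

Section SauerShelah.
Variable J : finType.
Implicit Types (F : {set {set J}}) (S A B : {set J}).

Definition shatters F S := [forall A : {set J}, (A \subset S) ==> [exists B in F, B :&: S == A]].

Lemma shattersP F S : reflect (forall A, A \subset S -> exists2 B, B \in F & B :&: S = A) (shatters F S).
Proof.
apply: (iffP forallP) => h A; first by move=> AS; have /implyP/(_ AS)/exists_inP[B BF /eqP] := h A; exists B.
by apply/implyP => /h[B BF BA]; apply/exists_inP; exists B; rewrite ?BA.
Qed.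

Lemma shattersS F1 F2 S : F1 \subset F2 -> shatters F1 S -> shatters F2 S.
Proof.
move=> /subsetP F12 /shattersP h; apply/shattersP => A /h[B BF BA].
by exists B; rewrite ?F12.
Qed.

(** Pajor's form of the Sauer-Shelah lemma.  Split the family according to an
    element [x] on which two members differ: a set shattered by one part is
    shattered by the whole, and a set shattered by both parts is still
    shattered after adding [x]. *)
Lemma pajor F : (#|F| <= #|[set S | shatters F S]|)%N.
Proof.
elim: {F}_.+1 {-2}F (ltnSn #|F|) => // m IH F Fm.
have [F1|F1] := leqP #|F| 1.
  case: (set_0Vmem F) => [->|[B BF]]; first by rewrite cards0.
  apply: leq_trans F1 _; rewrite card_gt0; apply/set0Pn; exists set0.
  rewrite inE; apply/shattersP => A; rewrite subset0 => /eqP ->.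
  by exists B; rewrite ?setI0.
have [B1 [B2 [B1F B2F B12]]] := card_gt1P F1.
have [x [C1 [C0 [C1F C0F x1 x0]]]] : exists x C1 C0, [/\ C1 \in F, C0 \in F, x \in C1 & x \notin C0].
  case: (boolP (B1 \subset B2)) => [s12|/subsetPn[x xB1 xB2]]; last by exists x, B1, B2.
  have /subsetPn[x xB2 xB1] : ~~ (B2 \subset B1).
    by apply: contraNN B12 => s21; rewrite eqEsubset s12.
  by exists x, B2, B1.
pose F1' := [set B in F | x \in B]; pose F0' := [set B in F | x \notin B].
have cF : (#|F1'| + #|F0'| = #|F|)%N.
  rewrite -(cardsID [set B : {set J} | x \in B] F); congr (_ + _)%N; apply: eq_card => B.
    by rewrite !inE.
  by rewrite !inE andbC.
have c1 : (0 < #|F1'|)%N by apply/card_gt0P; exists C1; rewrite inE C1F.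
have c0 : (0 < #|F0'|)%N by apply/card_gt0P; exists C0; rewrite inE C0F.
have s1 : F1' \subset F by apply/subsetP => B; rewrite inE => /andP[].
have s0 : F0' \subset F by apply/subsetP => B; rewrite inE => /andP[].
have IH1 : (#|F1'| <= #|[set S | shatters F1' S]|)%N by apply: IH; lia.
have IH0 : (#|F0'| <= #|[set S | shatters F0' S]|)%N by apply: IH; lia.
set S1 := [set S | shatters F1' S] in IH1 *; set S0 := [set S | shatters F0' S] in IH0 *.
have xS1 S : S \in S1 -> x \notin S.
  rewrite inE => /shattersP h; apply/negP => xS.
  have [|B] := h set0; first exact: sub0set.
  by rewrite inE => /andP[_ xB] /setP/(_ x); rewrite !inE xB xS.
have xS0 S : S \in S0 -> x \notin S.
  rewrite inE => /shattersP h; apply/negP => xS.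
  have [|B] := h S; first exact: subxx.
  by rewrite inE => /andP[_ xB] /setP/(_ x); rewrite !inE xS (negbTE xB).
pose I := [set x |: S | S in S1 :&: S0].
have cI : #|I| = #|S1 :&: S0|.
  apply: card_in_imset => S T; rewrite !in_setI => /andP[/xS1 xS _] /andP[/xS1 xT _] e.
  by rewrite -(setU1K xS) e setU1K.
have dI : [disjoint S1 :|: S0 & I].
  apply/pred0P => S /=; apply/negbTE/negP => /andP[SU /imsetP[T _ ST]].
  have xS : x \in S by rewrite ST setU11.
  by move: SU; rewrite in_setU => /orP[/xS1|/xS0]; rewrite xS.
rewrite -cF; apply: leq_trans (leq_add IH1 IH0) _.
rewrite -cardsUI -cI.
have -> : (#|S1 :|: S0| + #|I| = #|(S1 :|: S0) :|: I|)%N.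
  by rewrite [RHS]cardsU (disjoint_setI0 dI) cards0 subn0.
apply: subset_leq_card; apply/subsetP => S; rewrite in_setU => /orP[|/imsetP[T TI ->]].
  by rewrite in_setU !inE => /orP[]; apply: shattersS.
move: TI; rewrite in_setI => /andP[T1 T0]; have xT := xS1 _ T1.
move: T1 T0; rewrite !inE => /shattersP h1 /shattersP h0; apply/shattersP => A AxT.
have AT : A :\ x \subset T by rewrite subDset.
case: (boolP (x \in A)) => xA.
  have [B] := h1 _ AT; rewrite inE => /andP[BF xB] BA; exists B => //.
  by rewrite setIUr BA (setIidPr _) ?sub1set // setD1K.
have [B] := h0 _ AT; rewrite inE => /andP[BF xB] BA; exists B => //.
rewrite setIUr BA; have -> : B :&: [set x] = set0.
  by apply/setP => y; rewrite !inE; case: eqP => [->|]; rewrite ?andbF // (negbTE xB).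
by rewrite set0U; apply/setDidPl; rewrite disjoint_sym disjoints1.
Qed.

Lemma card_small_sets D : (#|[set S : {set J} | (#|S| <= D)%N]| <= #|J|.+1 ^ D)%N.
Proof.
pose im (f : {ffun 'I_D -> option J}) := [set j | Some j \in codom f].
apply: (@leq_trans #|im @: setT|).
  apply: subset_leq_card; apply/subsetP => S; rewrite inE => SD.
  apply/imsetP; exists [ffun i : 'I_D => nth None (map some (enum S)) i] => //.
  apply/setP => j; rewrite inE; apply/idP/codomP => [jS|[i]].
    have ij : (index j (enum S) < D)%N.
      by apply: leq_trans SD; rewrite cardE index_mem mem_enum.
    exists (Ordinal ij); rewrite ffunE /= (nth_map j) ?nth_index ?index_mem ?mem_enum //.
  rewrite ffunE; case: (ltnP i (size (enum S))) => iS.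
    by rewrite (nth_map j) // => -[->]; rewrite -mem_enum mem_nth.
  by rewrite nth_default // size_map.
apply: leq_trans (leq_imset_card _ _) _.
by rewrite cardsT card_ffun card_ord card_option.
Qed.
End SauerShelah.

Section Patterns.
Variables (R : realFieldType) (D : nat) (J : finType).
Local Notation V := 'rV[R]_D.

Definition ev (x : V) (l : 'cV[R]_D) : R := (x *m l) 0 0.

Lemma evD x y l : ev (x + y) l = ev x l + ev y l.
Proof. by rewrite /ev mulmxDl mxE. Qed.
Lemma evZ c x l : ev (c *: x) l = c * ev x l.
Proof. by rewrite /ev -scalemxAl mxE. Qed.
Lemma ev0 l : ev 0 l = 0. Proof. by rewrite /ev mul0mx mxE. Qed.
Lemma evN x l : ev (- x) l = - ev x l.
Proof. by rewrite -scaleN1r evZ mulN1r. Qed.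
Lemma evB x y l : ev (x - y) l = ev x l - ev y l.
Proof. by rewrite evD evN. Qed.
Lemma ev_lincomb (a : nat -> R) s l : ev (lincomb a s) l = \sum_(i < size s) a i * ev s`_i l.
Proof. by rewrite /ev /lincomb mulmx_suml summxE; apply: eq_bigr => i _; rewrite -scalemxAl mxE. Qed.

Variable Lam : J -> 'cV[R]_D.
Definition pattern (x : V) : {set J} := [set j | ev x (Lam j) < 0].
Definition patterns : {set {set J}} := [set Q | `[< exists x, Q = pattern x >]].

(** On a shattered set of dependent functionals some vector would be negative
    exactly on those with a positive coefficient, which makes the vanishing
    combination negative. *)
Lemma shattered_patterns S : shatters patterns S -> (#|S| <= D)%N.
Proof.
move=> /shattersP sh; rewrite leqNgt; apply/negP => SD.
have [c cS [j0 j0S cj0]] : exists2 c : J -> R, \sum_(j in S) c j *: Lam j = 0 &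
    exists2 j, j \in S & c j != 0.
  have [j0 j0S] : exists j, j \in S by apply/card_gt0P; apply: leq_ltn_trans SD.
  pose s : seq 'rV[R]_D := [seq (Lam j)^T | j <- enum S].
  have ss : size s = #|S| by rewrite size_map -cardE.
  have [|a as0 [i hi ai]] := @exists_dependency R D s; first by rewrite ss.
  exists (fun j => a (index j (enum S))); last first.
    have iS : (i < size (enum S))%N by rewrite -cardE -ss.
    exists (nth j0 (enum S) i); first by rewrite -mem_enum mem_nth.
    by rewrite index_uniq // enum_uniq.
  apply: trmx_inj; rewrite trmx0 -as0 /lincomb -(big_mkord xpredT (fun i => a i *: s`_i)).
  rewrite raddf_sum -big_enum (big_nth j0) size_map big_nat_cond [RHS]big_nat_cond.
  apply: eq_bigr => k /andP[/andP[_ kS] _] /=.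
  by rewrite index_uniq ?enum_uniq // linearZ /= (nth_map j0 0).
have cE x : \sum_(j in S) c j * ev x (Lam j) = 0.
  transitivity (ev x (\sum_(j in S) c j *: Lam j)); last by rewrite cS /ev mulmx0 mxE.
  by rewrite /ev mulmx_sumr summxE; apply: eq_bigr => j _; rewrite -scalemxAr [RHS]mxE.
have key (c' : J -> R) : (forall x, \sum_(j in S) c' j * ev x (Lam j) = 0) ->
    forall j, j \in S -> c' j <= 0.
  move=> c'E j jS; rewrite leNgt; apply/negP => cj.
  have [|Q] := sh [set j in S | 0 < c' j].
    by apply/subsetP => k; rewrite inE => /andP[].
  rewrite inE => /asboolP[x ->] /setP xE.
  have pE k : k \in S -> (ev x (Lam k) < 0) = (0 < c' k).
    by move=> kS; have := xE k; rewrite !inE kS andbT.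
  suff : \sum_(j in S) c' j * ev x (Lam j) < 0 by rewrite c'E ltxx.
  rewrite (bigD1 j) //= -[ltRHS]addr0 ltr_leD //; first by rewrite pmulr_rlt0 // pE.
  apply: sumr_le0 => k /andP[kS _]; have := pE k kS.
  case: ltP => [x0 /esym c0|x0 /esym/negbT]; first by rewrite mulr_ge0_le0 // ltW.
  by rewrite -leNgt => c0; rewrite mulr_le0_ge0.
move/eqP: cj0; apply; apply/eqP; rewrite eq_le (key c) //=.
rewrite -oppr_le0 (key (fun j => - c j)) // => x.
by under eq_bigr => j _ do rewrite mulNr; rewrite sumrN cE oppr0.
Qed.

Lemma card_patterns : (#|patterns| <= #|J|.+1 ^ D)%N.
Proof.
apply: leq_trans (pajor _) _; apply: leq_trans (card_small_sets J D).
apply: subset_leq_card; apply/subsetP => S; rewrite !inE; exact: shattered_patterns.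
Qed.
End Patterns.

(** * Triangulating the cells of a central arrangement *)

Section Triangulation.
Variables (R : realFieldType) (D : nat).
Local Notation V := 'rV[R]_D.

Definition in_kernel (T : 'I_D -> option 'cV[R]_D) (x : V) :=
  x != 0 /\ forall i l, T i = Some l -> ev x l = 0.

(** Only the values of the functionals enter, so that a vertex depends on no
    more of the arrangement than the functionals that define it. *)
Definition kernel_vector (T : 'I_D -> option 'cV[R]_D) : V :=
  if pselect (exists x, in_kernel T x) is left h then projT1 (cid h) else 0.

Lemma kernel_vectorP T x : in_kernel T x -> in_kernel T (kernel_vector T).
Proof.
move=> h; rewrite /kernel_vector; case: pselect => [h'|]; first by case: cid.
by case; exists x.
Qed.

(** Strict positivity of all the coefficients makes [x] a relative interior
    point of the cone; zero vectors in [s] are harmless padding. *)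
Definition pos (x : V) (s : seq V) :=
  exists2 a : nat -> R, (forall i, 0 < a i) & x = lincomb a s.

Lemma pos_cons c x y s : 0 < c -> pos y s -> pos (c *: x + y) (x :: s).
Proof.
move=> c0 [a a0 ->]; exists (fun i => if i is k.+1 then a k else c) => [[|i]//|].
by rewrite lincomb_cons.
Qed.

Lemma pos_cons0 y s : pos y s -> pos y (0 :: s).
Proof. by move=> /(pos_cons 0 ltr01); rewrite scaler0 add0r. Qed.

Definition crossed (s : seq V) (l : 'cV[R]_D) :=
  exists x y, [/\ x \in s, y \in s, 0 < ev x l & ev y l < 0].

(** This is where relative interiority matters: a functional of constant sign
    on [s] that is nonnegative at [x] cannot be negative on [s], even when it
    vanishes at [x]. *)
Lemma pos_uncrossed x s l : pos x s -> ~ crossed s l -> 0 <= ev x l ->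
  forall y, y \in s -> 0 <= ev y l.
Proof.
move=> [a a0 ->] nc; rewrite ev_lincomb => e0 y ys; rewrite leNgt; apply/negP => y0.
have neg i : (i < size s)%N -> ev s`_i l <= 0.
  move=> si; rewrite leNgt; apply/negP => i0; apply: nc.
  by exists s`_i, y; rewrite mem_nth.
have iy : (index y s < size s)%N by rewrite index_mem.
move: e0; apply/negP; rewrite -ltNge (bigD1 (Ordinal iy)) //= -[ltRHS]addr0 ltr_leD //.
  by rewrite nth_index // pmulr_rlt0.
by apply: sumr_le0 => i _; rewrite pmulr_rle0 // neg.
Qed.

Variable J : finType.

(** An extreme ray is the common kernel of at most [D] functionals, with a
    sign; no sign stands for the zero vector. *)
Definition vertex_code := ({ffun 'I_D -> option J} * option bool)%type.

Definition vertex (Lam : J -> 'cV[R]_D) (c : vertex_code) : V :=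
  if c.2 is Some b then (-1) ^+ b *: kernel_vector (fun i => omap Lam (c.1 i)) else 0.

Definition zero_code : vertex_code := ([ffun=> None], None).

Variable Lam : J -> 'cV[R]_D.
Hypothesis span : forall x, (forall j, ev x (Lam j) = 0) -> x = 0.
Variable Q : {set J}.

Definition signed_ev (x : V) j := (-1) ^+ (j \in Q) * ev x (Lam j).
(** The face on which the functionals in [h] vanish, of the closed cell with
    sign pattern [Q]. *)
Definition cell_face (h : seq J) x := (forall j, 0 <= signed_ev x j) /\ forall j, j \in h -> ev x (Lam j) = 0.

Lemma signed_evD x y j : signed_ev (x + y) j = signed_ev x j + signed_ev y j.
Proof. by rewrite /signed_ev evD mulrDr. Qed.
Lemma signed_evZ c x j : signed_ev (c *: x) j = c * signed_ev x j.
Proof. by rewrite /signed_ev evZ mulrCA. Qed.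
Lemma signed_ev_eq0 x j : (signed_ev x j == 0) = (ev x (Lam j) == 0).
Proof. by rewrite /signed_ev mulf_eq0 signr_eq0. Qed.

Fixpoint face_space (h : seq J) : 'M[R]_D :=
  if h is j :: h' then (face_space h' :&: kermx (Lam j))%MS else 1%:M.

Lemma mem_face_space h (x : V) : (x <= face_space h)%MS <-> forall j, j \in h -> ev x (Lam j) = 0.
Proof.
elim: h => [|j h IH] /=; first by rewrite submx1.
rewrite sub_capmx; split.
  move=> /andP[/IH xh /sub_kermxP xj] k; rewrite inE => /orP[/eqP->|/xh//].
  by rewrite /ev xj mxE.
move=> xh; apply/andP; split.
  by apply/IH => k kh; apply: xh; rewrite inE kh orbT.
apply/sub_kermxP/matrixP => a b; rewrite !ord1 -[LHS]/(ev x (Lam j)) xh ?mxE //.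
by rewrite mem_head.
Qed.

Lemma rank_face_space_lt j h x : (x <= face_space h)%MS -> ev x (Lam j) != 0 -> (\rank (face_space (j :: h)) < \rank (face_space h))%N.
Proof.
move=> xh xj; rewrite rank_ltmx // ltmxE capmxSl /=.
apply: contra xj => s; apply/eqP.
by apply: ((mem_face_space (j :: h) x).1 (submx_trans xh s)); exact: mem_head.
Qed.

Lemma ray_shoot h x u : cell_face h x -> (forall j, j \in h -> ev u (Lam j) = 0) ->
  (exists j, 0 < signed_ev u j) ->
  exists t j, [/\ 0 <= t, 0 < signed_ev u j & cell_face (j :: h) (x - t *: u)].
Proof.
move=> [x0 xh] uh [j0 uj0].
pose P := [pred j | 0 < signed_ev u j].
case: (@arg_minP _ _ _ j0 P (fun j => signed_ev x j / signed_ev u j) uj0) => j /= uj jmin.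
exists (signed_ev x j / signed_ev u j), j; split=> //; first by rewrite divr_ge0 // ltW.
have E k : signed_ev (x - (signed_ev x j / signed_ev u j) *: u) k = signed_ev x k - signed_ev x j / signed_ev u j * signed_ev u k.
  by rewrite -scaleNr signed_evD signed_evZ mulNr.
split=> k.
  rewrite E subr_ge0; case: (ltP 0 (signed_ev u k)) => uk.
    by rewrite -ler_pdivlMr //; apply: jmin.
  apply: le_trans (x0 k); rewrite mulr_ge0_le0 // divr_ge0 //; exact: ltW.
rewrite inE => /orP[/eqP->|kh].
  by apply/eqP; rewrite -signed_ev_eq0 E divfK ?subrr // gt_eqF.
by rewrite evB evZ uh // xh // mulr0 subr0.
Qed.

Lemma face_space_rank0 h (x : V) : \rank (face_space h) = 0%N -> (x <= face_space h)%MS -> x = 0.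
Proof. by move/eqP; rewrite mxrank_eq0 => /eqP ->; rewrite submx0 => /eqP. Qed.

(** Shooting a ray from [x] inside a face, in either direction that leaves the
    cell, lands in a smaller face; the descent stops at an extreme ray. *)
Lemma vertex_exists k h x : (size h + \rank (face_space h) <= D)%N -> (\rank (face_space h) <= k)%N ->
  x != 0 -> cell_face h x -> exists c, vertex Lam c != 0 /\ cell_face h (vertex Lam c).
Proof.
elim: k h x => [|k IH] h x sh rk x0 fx.
  by move: x0; rewrite (@face_space_rank0 h x) ?eqxx //; [apply/eqP; rewrite -leqn0|apply/mem_face_space; case: fx].
have xW : (x <= face_space h)%MS by apply/mem_face_space; case: fx.
(* Either the face is the ray of [x], cut out by the functionals in [h], or
   it contains a direction independent of [x]. *)
case: (boolP (face_space h <= x)%MS) => Wx.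
    pose T : {ffun 'I_D -> option J} := [ffun i : 'I_D => nth None (map some h) i].
  have hT i j : T i = Some j -> j \in h.
    rewrite ffunE; case: (ltnP i (size h)) => ih; last by rewrite nth_default // size_map.
    by rewrite (nth_map j) // => -[<-]; rewrite mem_nth.
  have Th j : j \in h -> exists i, T i = Some j.
    move=> jh; have ij : (index j h < D)%N.
      apply: leq_trans sh; apply: leq_trans (leq_addr _ _); by rewrite index_mem.
    by exists (Ordinal ij); rewrite ffunE /= (nth_map j) ?nth_index ?index_mem.
  have kx : in_kernel (fun i => omap Lam (T i)) x.
    split=> // i l; case E : (T i) => [j|//] [<-].
    by have [_ ->] := fx; rewrite ?(hT i).
  have [l0 lh] := kernel_vectorP kx; set y := kernel_vector _ in l0 lh.
  have yW : (y <= face_space h)%MS.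
    by apply/mem_face_space => j /Th[i Ti]; apply: (lh i); rewrite Ti.
  have /sub_rVP[c yc] := submx_trans yW Wx.
  have c0 : c != 0 by apply: contra_neq l0 => c0; rewrite yc c0 scale0r.
  exists (T, Some (c < 0)).
  have -> : vertex Lam (T, Some (c < 0)) = `|c| *: x.
    rewrite /vertex /= -/y yc scalerA; congr (_ *: _).
    by rewrite normrEsign.
  split; first by rewrite scaler_eq0 normr_eq0 negb_or c0.
  split=> j; first by rewrite signed_evZ mulr_ge0 //; case: fx.
  by move=> jh; rewrite evZ; case: fx => _ ->; rewrite ?mulr0.
have [i ui] : exists i, ~~ (row i (face_space h) <= x)%MS by apply/row_subPn.
set u := row i (face_space h) in ui.
have uW : (u <= face_space h)%MS by apply: row_sub.
have uh : forall j, j \in h -> ev u (Lam j) = 0 by apply/mem_face_space.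
have u0 : u != 0 by apply: contraNneq ui => ->; rewrite sub0mx.
have [e eh] : exists e : bool, exists j, 0 < signed_ev ((-1) ^+ e *: u) j.
  apply: contrapT => /forallNP hn; move/eqP: u0; apply; apply: span => j.
  apply/eqP; rewrite -signed_ev_eq0 eq_le.
  have /forallNP/(_ j)/negP := hn false; rewrite scale1r -leNgt => -> /=.
  have /forallNP/(_ j)/negP := hn true.
  by rewrite signed_evZ mulN1r -leNgt oppr_le0.
pose u' := (-1) ^+ e *: u.
have u'h j : j \in h -> ev u' (Lam j) = 0 by move=> jh; rewrite evZ uh ?mulr0.
have [t [j [t0 uj fx']]] := ray_shoot fx u'h eh.
have u'W : (u' <= face_space h)%MS by rewrite scalemx_sub.
have rk' : (\rank (face_space (j :: h)) < \rank (face_space h))%N.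
  by apply: rank_face_space_lt u'W _; rewrite -signed_ev_eq0 gt_eqF.
have [|||c [c0 [fc fh]]] := IH (j :: h) (x - t *: u') _ _ _ fx'.
- by apply: leq_trans sh; rewrite /= addSnnS leq_add2l.
- by rewrite -ltnS (leq_trans rk').
- apply: contraNneq ui => /eqP; rewrite subr_eq0 => /eqP xt.
  have tn : t != 0 by apply: contra_neq x0 => t_0; rewrite xt t_0 scale0r.
  have -> : u = ((-1) ^+ e / t) *: x.
    by rewrite xt /u' [RHS]scalerA divfK // scalerA -expr2 sqrr_sign scale1r.
  exact: scalemx_sub.
by exists c; split=> //; split=> // k' kh; apply: fh; rewrite inE kh orbT.
Qed.

(** A vertex depending on the face only; this is what makes the number of
    cones of the triangulation small. *)
Definition chosen_vertex h : vertex_code :=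
  if pselect (exists c, vertex Lam c != 0 /\ cell_face h (vertex Lam c)) is left e then projT1 (cid e) else zero_code.

Lemma chosen_vertexP h x : (size h + \rank (face_space h) <= D)%N -> x != 0 -> cell_face h x ->
  vertex Lam (chosen_vertex h) != 0 /\ cell_face h (vertex Lam (chosen_vertex h)).
Proof.
move=> sh x0 fx; rewrite /chosen_vertex; case: pselect => [e|[]]; first by case: cid.
exact: (vertex_exists sh (leqnn _) x0 fx).
Qed.

(** Generators of a cone of the pulling triangulation: the chosen vertices of
    a flag of faces, each being cut out of the previous one by the functional
    [j].  The boolean tells whether the vertex is used with a nonzero weight;
    [None] pads the list once the zero vector is reached. *)
Fixpoint flag_vertices (h : seq J) (c : seq (option (J * bool))) : seq vertex_code :=
  match c with
  | [::] => [::]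
  | None :: c' => zero_code :: flag_vertices h c'
  | Some (j, b) :: c' => (if b then chosen_vertex h else zero_code) :: flag_vertices (j :: h) c'
  end.

Lemma size_flag_vertices h c : size (flag_vertices h c) = size c.
Proof. by elim: c h => //= -[[j b]|] c IH h /=; rewrite IH. Qed.

Lemma vertex_zero_code : vertex Lam zero_code = 0. Proof. by []. Qed.

(** Shoot from [x] away from the chosen vertex of the face: [x] is the sum of
    a multiple of this vertex and of a vector of a smaller face. *)
Lemma triangulate k h x : (size h + \rank (face_space h) <= D)%N -> (\rank (face_space h) <= k)%N -> cell_face h x ->
  exists c, [/\ size c = k, pos x (map (vertex Lam) (flag_vertices h c)) &
    forall y, y \in map (vertex Lam) (flag_vertices h c) -> forall j, 0 <= signed_ev y j].
Proof.
elim: k h x => [|k IH] h x sh rk fx.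
  exists [::]; split=> //; exists (fun=> 1) => //; rewrite lincomb_nil.
  by apply: (@face_space_rank0 h); [apply/eqP; rewrite -leqn0|apply/mem_face_space; case: fx].
have z0 j : 0 <= signed_ev 0 j by rewrite /signed_ev ev0 mulr0.
have [x0|x0] := eqVneq x 0.
  exists (nseq k.+1 None); rewrite size_nseq; split=> //.
    have -> : map (vertex Lam) (flag_vertices h (nseq k.+1 None)) = nseq k.+1 0.
      by elim: k.+1 => //= m <-; rewrite vertex_zero_code.
    elim: k.+1 => [|m IHm]; last by rewrite /=; apply: pos_cons0.
    by rewrite x0; exists (fun=> 1) => //; rewrite lincomb_nil.
  have -> : map (vertex Lam) (flag_vertices h (nseq k.+1 None)) = nseq k.+1 0.
    by elim: k.+1 => //= m <-; rewrite vertex_zero_code.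
  by move=> y; rewrite mem_nseq => /eqP ->.
have [b0 [bC bh]] := chosen_vertexP sh x0 fx; set b := vertex Lam (chosen_vertex h) in b0 bC bh.
have [j bj] : exists j, 0 < signed_ev b j.
  apply: contrapT => /forallNP hn; move/eqP: b0; apply; apply: span => j.
  by apply/eqP; rewrite -signed_ev_eq0 eq_le bC andbT leNgt; apply/negP/hn.
have [t [{bj}j [t0 bj fx']]] := ray_shoot fx bh (ex_intro _ j bj).
have bW : (b <= face_space h)%MS by apply/mem_face_space.
have rk' : (\rank (face_space (j :: h)) < \rank (face_space h))%N.
  by apply: rank_face_space_lt bW _; rewrite -signed_ev_eq0 gt_eqF.
have [||c [sc pc fc]] := IH (j :: h) (x - t *: b) _ _ fx'.
- by apply: leq_trans sh; rewrite /= addSnnS leq_add2l.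
- by rewrite -ltnS (leq_trans rk').
have [t_0|tn] := eqVneq t 0.
  exists (Some (j, false) :: c); split; rewrite /= ?sc //.
    by apply: pos_cons0; move: pc; rewrite t_0 scale0r subr0.
  by move=> y; rewrite inE => /orP[/eqP-> //|/fc].
exists (Some (j, true) :: c); split; rewrite /= ?sc //.
  rewrite -/b; have -> : x = t *: b + (x - t *: b) by rewrite addrC subrK.
  by apply: pos_cons => //; rewrite lt_def tn.
by move=> y; rewrite inE => /orP[/eqP-> //|/fc].
Qed.

End Triangulation.

Section Triangulate.
Variables (R : realFieldType) (D : nat) (J : finType) (Lam : J -> 'cV[R]_D).
Hypothesis span : forall x, (forall j, ev x (Lam j) = 0) -> x = 0.

Lemma size_flag_vertices_tuple Q (c : D.-tuple (option (J * bool))) :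
  size (flag_vertices Lam Q [::] c) == D.
Proof. by rewrite size_flag_vertices size_tuple. Qed.

(** All the cones of the triangulation: a flag is determined by the cell and
    by the functionals that cut its successive faces. *)
Definition flag_simplices : {set D.-tuple (vertex_code D J)} :=
  [set Tuple (size_flag_vertices_tuple p.1 p.2) |
     p in setX (patterns Lam) [set: D.-tuple (option (J * bool))]].

Lemma card_flag_simplices : (#|flag_simplices| <= #|J|.+1 ^ D * (#|J| * 2).+1 ^ D)%N.
Proof.
apply: leq_trans (leq_imset_card _ _) _; rewrite cardsX leq_mul ?card_patterns //.
by rewrite cardsT card_tuple card_option card_prod card_bool.
Qed.

Lemma flag_simplices_cover x : exists2 G : D.-tuple (vertex_code D J), G \in flag_simplices &
  pos x (map (vertex Lam) G) /\ forall j, ~ crossed (map (vertex Lam) G) (Lam j).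
Proof.
have fx : cell_face Lam (pattern Lam x) [::] x.
  split=> // j; rewrite /signed_ev inE; case: ltrP => xj; rewrite ?mulN1r ?mul1r //.
  by rewrite oppr_ge0 ltW.
have [||c [/eqP sc pc fc]] := @triangulate R D J Lam span (pattern Lam x) D [::] x _ _ fx.
- by rewrite /= mxrank1.
- by rewrite /= mxrank1.
exists (Tuple (size_flag_vertices_tuple (pattern Lam x) (Tuple sc))).
  apply/imsetP; exists (pattern Lam x, Tuple sc) => //.
  by rewrite !inE andbT; apply/asboolP; exists x.
split=> // j [y [z [yG zG y0 z0]]].
have := fc y yG j; have := fc z zG j; rewrite /signed_ev; case: (_ \in _).
  by move=> _; rewrite mulN1r oppr_ge0 leNgt y0.
by rewrite !mul1r leNgt z0.
Qed.
End Triangulate.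

(** * Cuttings by random sampling *)

Lemma expn_bernoulli x k : (x ^ k * (x + k) <= x.+1 ^ k * x)%N.
Proof.
elim: k => [|k IH]; first by rewrite addn0.
rewrite !expnS; set y := (x ^ k)%N in IH *; set z := (x.+1 ^ k)%N in IH *.
apply: (@leq_trans (x.+1 * (y * (x + k))))%N; last by rewrite -mulnA leq_mul2l IH orbT.
clear IH; nia.
Qed.

Lemma expn_half x : (2 * x ^ x.+1 <= x.+1 ^ x.+1)%N.
Proof.
case: x => [//|x]; have := expn_bernoulli x.+1 x.+2.
set y := (_ ^ _)%N; set z := (_ ^ _)%N => h.
rewrite -(@leq_pmul2r x.+1) //; apply: leq_trans h; nia.
Qed.

Lemma leq_expn m k e : (m <= k)%N -> (m ^ e <= k ^ e)%N.
Proof. by move=> mk; elim: e => // e IH; rewrite !expnS leq_mul. Qed.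

(** The integral form of [(1 - 1 / q) ^ w <= 2 ^ - (w / q)]. *)
Lemma expn_decay q a w : (0 < q)%N -> (q * a <= w)%N -> (q.-1 ^ w * 2 ^ a <= q ^ w)%N.
Proof.
case: q => // x _ /subnKC <-; move: (w - _)%N => r.
rewrite !(expnD _ (x.+1 * a) r) mulnAC; apply: leq_mul; last exact: leq_expn.
rewrite (expnM x) (expnM x.+1 x.+1 a) -[(_ * _)%N](expnMn (x ^ x.+1) 2 a).
by apply: leq_expn; rewrite mulnC; exact: expn_half.
Qed.

Section Cutting.
Variables (R : realFieldType) (D n : nat) (Om I : finType).
Local Notation V := 'rV[R]_D.
Variables (P : 'I_n -> V) (L : Om -> I -> 'cV[R]_D).

Section Sampling.
Variable s : nat.
Local Notation J := (('I_s * I) + 'I_D)%type.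
Local Notation sample := {ffun 'I_s -> Om}.

(** The coordinate functionals are added to the sampled ones in order that
    the cells be pointed. *)
Definition arrangement (t : sample) (j : J) : 'cV[R]_D :=
  match j with inl p => L (t p.1) p.2 | inr k => delta_mx k 0 end.

Lemma arrangement_span t x : (forall j, ev x (arrangement t j) = 0) -> x = 0.
Proof.
move=> h; apply/rowP => k; have := h (inr k); rewrite /ev /= -colE !mxE => ->; by [].
Qed.

Definition cuts (om : Om) (s : seq V) := exists i, crossed s (L om i).
Definition uncut (t : sample) (G : D.-tuple (vertex_code D J)) : {set Om} :=
  [set om | ~~ `[< cuts om (map (vertex (arrangement t)) G) >]].

Definition used_samples (G : D.-tuple (vertex_code D J)) : {set 'I_s} :=
  [set k | [exists i1, [exists i2,
     if (tnth G i1).1 i2 is Some (inl p) then p.1 == k else false]]].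

Lemma card_used_samples G : (#|used_samples G| <= D * D)%N.
Proof.
pose f (p : 'I_D * 'I_D) := if (tnth G p.1).1 p.2 is Some (inl q) then Some q.1 else None.
apply: (@leq_trans #|[set f p | p in setT]|); last first.
  by apply: leq_trans (leq_imset_card _ _) _; rewrite cardsT card_prod card_ord.
rewrite -(card_imset _ (@Some_inj _)); apply: subset_leq_card; apply/subsetP => z /imsetP[k].
rewrite inE => /existsP[i1 /existsP[i2 h]] ->; apply/imsetP; exists (i1, i2) => //.
by move: h; rewrite /f /=; case: ((tnth G i1).1 i2) => [[q|q]|] // /eqP ->.
Qed.

Lemma uncut_indep (t t' : sample) G : {in used_samples G, t =1 t'} -> uncut t G = uncut t' G.
Proof.
move=> tt'; rewrite /uncut; suff -> : map (vertex (arrangement t)) G = map (vertex (arrangement t')) G by [].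
apply/eq_in_map => c cG; rewrite /vertex; case: c.2 => // b; congr (_ *: kernel_vector _).
apply: funext => i; case E : (c.1 i) => [[p|k]|] //=; rewrite tt' //.
have /tnthP[i1 ci] := cG.
rewrite inE; apply/existsP; exists i1; apply/existsP; exists i.
by rewrite -ci E.
Qed.

Section Missed.
Variables (q : nat) (G : D.-tuple (vertex_code D J)).
(** The samples for which the cone with code [G] is cut by at least a fraction
    [1 / q] of all elements of [Om] and yet by no sampled one in [U]. *)
Definition missed (U : {set 'I_s}) : {set sample} :=
  [set t | (#|uncut t G| * q <= q.-1 * #|Om|)%N & [forall k in U, t k \in uncut t G]].

(** The cone does not depend on a sample [k] outside its definition, so when
    [t k] is redrawn it leaves the cone uncut with probability at most
    [1 - 1 / q]. *)
Lemma card_missed_step (U : {set 'I_s}) k : k \notin used_samples G -> k \notin U -> (0 < #|Om|)%N ->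
  (#|missed (k |: U)| * q <= q.-1 * #|missed U|)%N.
Proof.
move=> kG kU Om0.
have uE t om : uncut (upd t k om) G = uncut t G.
  by apply: uncut_indep => i iG; rewrite upd_neq //; apply: contraNneq kG => <-.
have E (B : {set sample}) : #|B| = (\sum_t (t \in B))%N.
  by rewrite -sum1_card big_mkcond; apply: eq_bigr => t _; case: ifP.
rewrite -(leq_pmul2l Om0) mulnA {1}E -(sum_upd (fun t => (t \in missed (k |: U)) : nat) k).
apply: (@leq_trans ((\sum_t (t \in missed U) * #|uncut t G|) * q))%N.
  rewrite leq_mul2r; apply/orP; right; apply: leq_sum => t _.
  rewrite -[#|uncut t G|]sum1_card big_distrr /= [X in (_ <= X)%N]big_mkcond.
  apply: leq_sum => om _; case: (boolP (upd t k om \in _)) => //.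
  rewrite inE uE => /andP[h /forall_inP hf].
  have -> : om \in uncut t G by have := hf k (setU11 _ _); rewrite upd_eq.
  suff -> : t \in missed U by [].
  rewrite inE h; apply/forall_inP => i iU; have := hf i; rewrite inE iU orbT => /(_ isT).
  by rewrite upd_neq //; apply: contraNneq kU => <-.
rewrite big_distrl /= [X in (_ <= X)%N]mulnA E big_distrr /=; apply: leq_sum => t _.
case: (boolP (t \in missed U)) => tB; last by rewrite mul0n.
by move: tB; rewrite inE => /andP[h _]; rewrite mul1n muln1 [X in (_ <= X)%N]mulnC.
Qed.

Lemma card_missed (U : {set 'I_s}) : [disjoint U & used_samples G] -> (0 < #|Om|)%N ->
  (#|missed U| * q ^ #|U| <= q.-1 ^ #|U| * #|Om| ^ s)%N.
Proof.
move: {2}#|U| (erefl #|U|) => m; elim: m U => [|m IH] U Um dU Om0.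
  rewrite Um muln1 mul1n; apply: leq_trans (max_card _) _.
  by rewrite card_ffun card_ord.
have [k kU] : exists k, k \in U by apply/card_gt0P; rewrite Um.
have kG : k \notin used_samples G by rewrite (disjointFr dU).
have Uk : #|U :\ k| = m by have := cardsD1 k U; rewrite kU Um => -[->].
have dk : [disjoint U :\ k & used_samples G] by apply: disjointWl dU; apply: subsetDl.
have := card_missed_step kG (negbT (setD11 k U)) Om0; rewrite setD1K // => st.
have := IH _ Uk dk Om0; rewrite Uk Um !expnS => h.
rewrite mulnA; apply: leq_trans (leq_mul st (leqnn _)) _.
by rewrite -!mulnA leq_mul2l h orbT.
Qed.
End Missed.

(** Union bound over the codes of cones, each of which involves at most
    [D * D] samples and is tested by the remaining ones. *)
Lemma exists_good_sample q a : (0 < q)%N -> (q * a + D * D <= s)%N -> (0 < #|Om|)%N ->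
  ((3 * #|{: J}|.+1 ^ D) ^ D < 2 ^ a)%N ->
  exists t : sample, forall G : D.-tuple (vertex_code D J),
    (forall k, t k \in uncut t G) -> (q.-1 * #|Om| < #|uncut t G| * q)%N.
Proof.
move=> q0 sa Om0 ha; apply: contrapT => /forallNP hn.
have cov : [set: sample] \subset \bigcup_(G : D.-tuple (vertex_code D J)) missed q G (~: used_samples G).
  apply/subsetP => t _; have /existsNP[G /not_implyP[h1 h2]] := hn t.
  apply/bigcupP; exists G => //; rewrite inE leqNgt; apply/andP; split; first exact/negP.
  by apply/forall_inP => k _; apply: h1.
have c1 G : (#|missed q G (~: used_samples G)| * 2 ^ a <= #|Om| ^ s)%N.
  have := @card_missed q G (~: used_samples G).
  rewrite -setI_eq0 setIC setICr eqxx => /(_ isT Om0).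
  set w := #|~: used_samples G|; have hw : (q * a <= w)%N.
    have := cardsC (used_samples G); rewrite -/w card_ord => e.
    have := card_used_samples G; move: e sa; clear; lia.
  move=> h; rewrite -(@leq_pmul2r (q ^ w)) ?expn_gt0 ?q0 // mulnAC.
  apply: leq_trans (leq_mul h (leqnn _)) _.
  by rewrite mulnAC mulnC leq_mul2l expn_decay ?orbT.
have S0 : (0 < #|Om| ^ s)%N by rewrite expn_gt0 Om0.
suff : (#|Om| ^ s * 2 ^ a <= (3 * #|{: J}|.+1 ^ D) ^ D * #|Om| ^ s)%N.
  by rewrite mulnC leq_pmul2r // leqNgt ha.
have -> : (#|Om| ^ s = #|[set: sample]|)%N by rewrite cardsT card_ffun card_ord.
apply: leq_trans (leq_mul (subset_leq_card cov) (leqnn _)) _.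
have le : (#|\bigcup_(G : D.-tuple (vertex_code D J)) missed q G (~: used_samples G)| <=
   \sum_(G : D.-tuple (vertex_code D J)) #|missed q G (~: used_samples G)|)%N.
  elim/big_rec2: _ => [|j x y' _ le]; first by rewrite cards0.
  apply: leq_trans (_ : #|missed q j (~: used_samples j)| + #|y'| <= _)%N; last by rewrite leq_add2l.
  by rewrite cardsU leq_subr.
apply: leq_trans (leq_mul le (leqnn _)) _; rewrite big_distrl /=.
apply: leq_trans (leq_sum _ (fun G _ => c1 G)) _.
rewrite sum_nat_const cardT -cardE cardsT card_ffun card_ord leq_mul2r; apply/orP; right.
by rewrite card_tuple card_prod !card_option card_bool card_ffun card_ord card_option mulnC.
Qed.
End Sampling.

Definition compatible (a : 'I_n) : {set Om} := [set om | [forall i, 0 <= ev (P a) (L om i)]].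

(** At least [n / (2 e)] points are compatible with a fraction [1 / (2 e)] of
    [Om].  Distribute them over the cones of the triangulation given by a good
    sample and keep a most popular cone.  It is cut by less than a fraction
    [1 / (4 e)] of [Om], and an element compatible with a point of the cone and
    not cutting it is compatible with the generators, by [pos_uncrossed]. *)
Theorem cutting_lemma (e a : nat) : (0 < e)%N -> (0 < n)%N -> (0 < #|Om|)%N ->
  let s := (4 * e * a + D * D)%N in let m := (s * #|I| + D)%N in
  ((3 * m.+1 ^ D) ^ D < 2 ^ a)%N ->
  (n * #|Om| <= e * \sum_a #|compatible a|)%N ->
  exists (G : seq V) (S : {set 'I_n}), [/\ size G = D,
    (n <= #|S| * (2 * e * (m.+1 ^ D * (m * 2).+1 ^ D)))%N,
    forall b, b \in S -> pos (P b) G &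
    (#|Om| <= 4 * e * #|[set om | [forall i, all (fun y => 0 <= ev y (L om i))%R G]]|)%N].
Proof.
move=> e0 n0 Om0 s m ha hE.
pose J := (('I_s * I) + 'I_D)%type.
have cJ : #|{: J}| = m by rewrite card_sum card_prod !card_ord.
have [||||t ht] := @exists_good_sample s (4 * e) a; rewrite ?cJ //.
  by rewrite muln_gt0.
have /choice[g hg] (b : 'I_n) : exists G : D.-tuple (vertex_code D J), G \in flag_simplices (arrangement t) /\
  (pos (P b) (map (vertex (arrangement t)) G) /\ forall j, ~ crossed (map (vertex (arrangement t)) G) (arrangement t j)).
  by have [G ? ?] := flag_simplices_cover (@arrangement_span s t) (P b); exists G.
pose S0 := [set b | #|Om| <= 2 * e * #|compatible b|]%N.
(* [S0] keeps the points whose degree is at least half of the average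
   guaranteed by the hypothesis; a Markov bound gives its size. *)
have nS0 : (n <= 2 * e * #|S0|)%N.
  rewrite -(@leq_pmul2r #|Om|) //.
  have : (2 * e * \sum_b #|compatible b| <= 2 * e * #|S0| * #|Om| + n * #|Om|)%N.
    have -> : (2 * e * #|S0| * #|Om| + n * #|Om| = \sum_(b < n) ((b \in S0) * (2 * e * #|Om|) + #|Om|))%N.
      rewrite big_split /= sum_nat_const card_ord; congr (_ + _)%N.
      rewrite -big_distrl /= -mulnA mulnCA; congr (_ * _)%N.
      by rewrite -sum1_card big_mkcond; apply: eq_bigr => t' _; case: ifP.
    rewrite big_distrr /=; apply: leq_sum => b _; rewrite inE; case: (leqP #|Om| (2 * e * _)) => h.
      by rewrite mul1n; apply: leq_trans (leq_addr _ _); rewrite leq_mul2l max_card orbT.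
    by rewrite mul0n add0n ltnW.
  have := leq_mul (leqnn 2) hE; set A := (\sum_b _)%N; set B := #|Om|; set C := #|S0|.
  clear; nia.
have [G GS hG] : exists2 G, G \in flag_simplices (arrangement t) &
    (#|S0| <= #|[set b in S0 | g b == G]| * #|flag_simplices (arrangement t)|)%N.
  apply: contrapT => /forall2NP hn.
  have lt G : G \in flag_simplices (arrangement t) -> (#|[set b in S0 | g b == G]| * #|flag_simplices (arrangement t)| < #|S0|)%N.
    by move=> GS; have [//|/negP] := hn G; rewrite -ltnNge.
  have S0E : #|S0| = (\sum_(G in flag_simplices (arrangement t)) #|[set b in S0 | g b == G]|)%N.
    rewrite -sum1_card (partition_big g (mem (flag_simplices (arrangement t)))) /= => [|b _]; last by case: (hg b).
    by apply: eq_bigr => G _; rewrite -sum1_card; apply: eq_bigl => b; rewrite inE.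
  have [G0 G0S] : exists G, G \in flag_simplices (arrangement t).
    by exists (g (Ordinal n0)); case: (hg (Ordinal n0)).
  have T0 : (0 < #|flag_simplices (arrangement t)|)%N by apply/card_gt0P; exists G0.
  have : (\sum_(G in flag_simplices (arrangement t)) (#|[set b in S0 | g b == G]| * #|flag_simplices (arrangement t)| + 1)
      <= #|flag_simplices (arrangement t)| * #|S0|)%N.
    by rewrite -sum_nat_const; apply: leq_sum => G GS; rewrite addn1; apply: lt.
  rewrite big_split /= sum_nat_const muln1 -big_distrl /= -S0E mulnC.
  by rewrite -[X in (_ <= X)%N]addn0 leq_add2l leqNgt T0.
exists (map (vertex (arrangement t)) G), [set b in S0 | g b == G]; split.
- by rewrite size_map size_tuple.
- apply: leq_trans nS0 _; rewrite mulnC; rewrite [X in (_ <= X)%N]mulnCA [X in (_ <= X)%N]mulnC leq_mul2r.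
  apply/orP; right; apply: leq_trans hG _; rewrite leq_mul2l.
  by apply/orP; right; rewrite -cJ card_flag_simplices.
- by move=> b; rewrite inE => /andP[_ /eqP <-]; case: (hg b) => _ [].
have [b bS] : exists b, b \in [set b in S0 | g b == G].
  apply/card_gt0P; rewrite lt0n; apply/eqP => c0; move: hG; rewrite c0 mul0n leqn0 => /eqP c00.
  by move: nS0; rewrite c00 muln0 leqNgt n0.
move: bS; rewrite !inE => /andP[degb /eqP gb].
have [_ [pG nG]] := hg b; rewrite gb in pG nG.
have good : forall k, t k \in uncut t G.
  move=> k; rewrite inE; apply/negP => /asboolP[i]; exact: (nG (inl (k, i))).
have uG := ht G good.
set Om' := [set om | _].
have sub : compatible b :&: uncut t G \subset Om'.
  apply/subsetP => om; rewrite !inE => /andP[/forallP db /asboolP nsp].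
  apply/forallP => i; apply/allP => y yG.
  by apply: (pos_uncrossed pG _ (db i) yG) => cr; apply: nsp; exists i.
have c2 : (#|compatible b| + #|uncut t G| <= #|Om'| + #|Om|)%N.
  by rewrite -cardsUI addnC; apply: leq_add; [exact: subset_leq_card|exact: max_card].
move: uG c2 degb e0; set A := #|uncut _ _|; set B := #|compatible _|; set C := #|Om'|; set E := #|Om|.
clear; nia.
Qed.
End Cutting.

(** * Complete subfamilies for multilinear inequalities *)

Section Iterate.
Variables (R : realFieldType) (D n : nat) (I0 : finType).
Local Notation V := 'rV[R]_D.
Variables (pt : 'I_D -> 'I_n -> V) (F : I0 -> 'M[R]_D -> R).
Local Notation tup := {ffun 'I_D -> 'I_n}.
Local Notation choices := {ffun 'I_D -> 'I_D}.

Definition updrow (A : 'M[R]_D) (k : 'I_D) (v : V) : 'M[R]_D :=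
  \matrix_(i < D) (if i == k then v else row i A).

Definition row_linear (f : 'M[R]_D -> R) :=
  forall A k, exists l, forall v, f (updrow A k v) = ev v l.

Hypothesis Flin : forall i, row_linear (F i).

(** The colours below [k] have been replaced by generators, one of which is
    chosen by [c] in each row. *)
Definition mixed_rows (k : nat) (G : 'I_D -> seq V) (c : choices) (f : tup) : 'M[R]_D :=
  \matrix_(i < D) (if (i < k)%N then (G i)`_(c i) else pt i (f i)).

Definition surviving k G := [set f : tup | [forall c, [forall i, 0 <= F i (mixed_rows k G c f)]]].

Lemma mixed_rows_upd (k : 'I_D) G c f a :
  mixed_rows k G c (upd f k a) = updrow (mixed_rows k G c f) k (pt k a).
Proof.
apply/row_matrixP => i; rewrite !rowK; have [->|ik] := eqVneq i k.
  by rewrite ltnn upd_eq.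
by rewrite upd_neq.
Qed.

Lemma mixed_rows_next (k : 'I_D) G G' c f :
  mixed_rows k.+1 (fun i => if i == k then G' else G i) c f = updrow (mixed_rows k G c f) k G'`_(c k).
Proof.
apply/row_matrixP => i; rewrite !rowK; have [->|ik] := eqVneq i k.
  by rewrite ltnSn.
by rewrite ltnS leq_eqVlt val_eqE (negbTE ik).
Qed.

(** The linear functional in row [k] of a row linear function. *)
Definition functional f k A : 'cV[R]_D :=
  if pselect (row_linear f) is left h then projT1 (cid (h A k)) else 0.

Lemma functionalP i A k v : F i (updrow A k v) = ev v (functional (F i) k A).
Proof. by rewrite /functional; case: pselect => // h; case: cid. Qed.

Variables (e0 a : nat).
Hypotheses (e0_gt0 : (0 < e0)%N) (n_gt0 : (0 < n)%N).
Let emax := (4 ^ D * e0)%N.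
Let m := ((4 * emax * a + D * D) * (D ^ D * #|I0|) + D)%N.
Hypothesis ha : ((3 * m.+1 ^ D) ^ D < 2 ^ a)%N.
Let B := (2 * emax * (m.+1 ^ D * (m * 2).+1 ^ D))%N.
Hypothesis dense : (n ^ D <=
  e0 * #|[set f : tup | [forall i, 0 <= F i (\matrix_(j < D) pt j (f j))]%R]|)%N.

(** Colour [k] is treated by [cutting_lemma], with the tuples playing the role
    of [Om] and one functional for each inequality and each choice of
    generators of the previous colours.  The density drops by a factor 4. *)
Lemma refine_colours k : (k <= D)%N -> exists (G : 'I_D -> seq V) (S : 'I_D -> {set 'I_n}),
  [/\ forall i, size (G i) = D,
      forall i : 'I_D, (i < k)%N -> (n <= #|S i| * B)%N /\ forall b, b \in S i -> pos (pt i b) (G i) &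
      (n ^ D <= 4 ^ k * e0 * #|surviving k G|)%N].
Proof.
elim: k => [|k IH] kD.
  exists (fun=> nseq D 0), (fun=> set0); split=> // [i|]; first by rewrite size_nseq.
  apply: leq_trans dense _; rewrite mul1n leq_mul2l; apply/orP; right.
  apply: subset_leq_card; apply/subsetP => f; rewrite !inE => /forallP h.
  apply/forallP => c; apply/forallP => i; have := h i.
  by congr (_ <= F i _); apply/row_matrixP => j; rewrite !rowK.
have [G [S [sG hS dens]]] := IH (ltnW kD).
pose ko := Ordinal kD; pose e := (4 ^ k * e0)%N.
have e_gt0 : (0 < e)%N by rewrite muln_gt0 expn_gt0.
have e_le : (e <= emax)%N by rewrite /e /emax leq_mul2r leq_exp2l // (ltnW kD) orbT.
pose L (f : tup) (p : choices * I0) := functional (F p.2) ko (mixed_rows k G p.1 f).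
have cI : #|{: choices * I0}| = (D ^ D * #|I0|)%N.
  by rewrite card_prod card_ffun !card_ord.
have LE (f : tup) (v : V) : [forall p, 0 <= ev v (L f p)] =
    [forall c, [forall i, 0 <= F i (updrow (mixed_rows k G c f) ko v)]].
  apply/forallP/forallP => [h c|h [c i]].
    by apply/forallP => i; rewrite functionalP; apply: (h (c, i)).
  by rewrite /L -functionalP; have /forallP := h c; apply.
have Om0 : (0 < #|{: tup}|)%N by rewrite card_ffun !card_ord expn_gt0 n_gt0.
have le_m : ((4 * e * a + D * D) * #|{: choices * I0}| + D <= m)%N.
  by rewrite cI /m leq_add2r leq_mul2r leq_add2r leq_mul2r leq_mul2l e_le !orbT.
have [||G' [S' [sG' cS' pS' dS']]] := @cutting_lemma R D n _ _ (pt ko) L e a e_gt0 n_gt0 Om0.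
- by apply: leq_ltn_trans ha; apply: leq_expn; rewrite leq_mul2l leq_expn.
- have -> : (\sum_b #|compatible (pt ko) L b| = n * #|surviving k G|)%N.
    have -> : #|surviving k G| = (\sum_f (f \in surviving k G))%N.
      by rewrite -sum1_card big_mkcond; apply: eq_bigr => f _; case: ifP.
    rewrite -[X in (_ = X * _)%N]card_ord -(sum_upd (fun f => (f \in surviving k G) : nat) ko) exchange_big /=.
    apply: eq_bigr => b _; rewrite -sum1_card big_mkcond; apply: eq_bigr => f _.
    rewrite !inE LE; congr (nat_of_bool _).
    by apply: eq_forallb => c; apply: eq_forallb => i; rewrite (mixed_rows_upd ko).
  by rewrite card_ffun !card_ord mulnCA leq_mul2l dens orbT.
pose Gn i := if i == ko then G' else G i.
exists Gn, (fun i => if i == ko then S' else S i); split.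
- by move=> i; rewrite /Gn; case: ifP.
- move=> i; rewrite ltnS leq_eqVlt /Gn -val_eqE /=; case: eqP => [ik _|_ /= ik]; last exact: hS.
  have -> : i = ko by apply: val_inj.
  split=> //; apply: leq_trans cS' _; rewrite leq_mul2l; apply/orP; right.
  by rewrite /B; apply: leq_mul; [rewrite leq_mul2l e_le orbT|
     apply: leq_mul; apply: leq_expn; rewrite ltnS ?leq_mul2r le_m ?orbT].
rewrite card_ffun !card_ord in dS'.
have -> : (4 ^ k.+1 * e0 = 4 * e)%N by rewrite expnS mulnA.
apply: leq_trans dS' _; rewrite leq_mul2l; apply/orP; right.
apply: subset_leq_card; apply/subsetP => f; rewrite !inE => /forallP h.
apply/forallP => c; apply/forallP => i; rewrite (mixed_rows_next ko) functionalP.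
by have /allP := h (c, i); apply; rewrite mem_nth // sG'.
Qed.

(** Inequalities that are linear in each row pass from the generators to the
    cones, one row at a time. *)
Lemma pos_extend (G : 'I_D -> seq V) (v : 'I_D -> V) i0 : (forall i, size (G i) = D) ->
  (forall i, pos (v i) (G i)) ->
  (forall c : choices, 0 <= F i0 (\matrix_(i < D) (G i)`_(c i))) ->
  0 <= F i0 (\matrix_(i < D) v i).
Proof.
move=> sG pv h.
pose M k (c : choices) : 'M[R]_D := \matrix_(i < D) (if (i < k)%N then v i else (G i)`_(c i)).
suff hM k c : (k <= D)%N -> 0 <= F i0 (M k c).
  case: (posnP D) => [D0|D_gt0].
    move: (h (finfun (fun i => i))); congr (_ <= F i0 _); apply/row_matrixP => i.
    by have := leq_trans (ltn_ord i) (eq_leq D0).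
  have := hM D (finfun (fun i => i)) (leqnn D); congr (_ <= F i0 _).
  by apply/row_matrixP => i; rewrite !rowK ltn_ord.
elim: k c => [|k IH] c kD.
  by have := h c; congr (_ <= F i0 _); apply/row_matrixP => i; rewrite !rowK.
pose ko := Ordinal kD.
have E j : M k (upd c ko j) = updrow (M k c) ko (G ko)`_j.
  apply/row_matrixP => i; rewrite !rowK; have [->|ik] := eqVneq i ko.
    by rewrite ltnn upd_eq.
  by rewrite upd_neq.
have -> : M k.+1 c = updrow (M k c) ko (v ko).
  apply/row_matrixP => i; rewrite !rowK; have [->|ik] := eqVneq i ko.
    by rewrite ltnSn.
  by move: ik; rewrite ltnS leq_eqVlt -val_eqE /= => /negbTE ->.
have [w w0 ->] := pv ko.
rewrite functionalP ev_lincomb; apply: sumr_ge0 => j _; rewrite mulr_ge0 ?(ltW (w0 _)) //.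
have jD : (j < D)%N by apply: leq_trans (ltn_ord j) (eq_leq (sG ko)).
by have := IH (upd c ko (Ordinal jD)) (ltnW kD); rewrite E functionalP.
Qed.

(** Once all the colours are replaced by generators, membership in
    [surviving] no longer depends on the tuple, so positive density means that
    all the inequalities hold at the generators. *)
Theorem complete_subfamily : exists S : 'I_D -> {set 'I_n},
  (forall i, n <= #|S i| * B)%N /\
  forall f : tup, (forall i, f i \in S i) -> forall i0, 0 <= F i0 (\matrix_(j < D) pt j (f j)).
Proof.
have [G [S [sG hS dens]]] := refine_colours (leqnn D).
exists S; split=> [i|f fS i0]; first by case: (hS i (ltn_ord i)).
apply: (pos_extend sG) => [i|c]; first by have [_] := hS i (ltn_ord i); apply.
have [g] : exists g, g \in surviving D G.
  apply/card_gt0P; rewrite lt0n; apply/eqP => z; move: dens; rewrite z muln0 leqn0.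
  by rewrite expn_eq0 (gtn_eqF n_gt0).
rewrite inE => /forallP/(_ c)/forallP/(_ i0); congr (_ <= F i0 _).
by apply/row_matrixP => j; rewrite !rowK ltn_ord.
Qed.
End Iterate.

(** * Overlapping simplices in the standard simplex *)

Section Cramer.
Variables (R : realFieldType) (D : nat) (x : 'rV[R]_D).

Lemma det_updrow (A : 'M[R]_D) k v : \det (updrow A k v) = ev v (col k (\adj A)).
Proof.
rewrite (expand_det_row _ k) /ev mxE; apply: eq_bigr => j _.
rewrite mxE eqxx !mxE; congr (_ * _); rewrite /cofactor; congr (_ * \det _).
by apply/matrixP => r s; rewrite !mxE eq_sym (negbTE (neq_lift _ _)) mxE.
Qed.

Lemma updrow_comm (A : 'M[R]_D) i k v w : i != k ->
  updrow (updrow A k v) i w = updrow (updrow A i w) k v.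
Proof.
move=> ik; apply/row_matrixP => r; rewrite !rowK.
by have [->|ri] := eqVneq r i; rewrite ?rowK ?(negbTE ik) ?eqxx // rowK (negbTE ri).
Qed.

Lemma updrow_twice (A : 'M[R]_D) k v w : updrow (updrow A k v) k w = updrow A k w.
Proof. by apply/row_matrixP => r; rewrite !rowK; case: eqP => // rk; rewrite rowK; case: eqP. Qed.

(** Cramer's numerators do not depend on row [i]; the factor [hgt (row i A)],
    which is 1 on points, makes them linear in this row too. *)
Definition cramer (s : R) (i : 'I_D) (A : 'M[R]_D) : R :=
  s * hgt (row i A) * \det (updrow A i x).

Lemma hgtE (v : 'rV[R]_D) : hgt v = ev v (const_mx 1).
Proof. by rewrite /ev mxE; apply: eq_bigr => j _; rewrite mxE mulr1. Qed.

Lemma evZr (v : 'rV[R]_D) c l : ev v (c *: l) = c * ev v l.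
Proof. by rewrite /ev -scalemxAr mxE. Qed.

Lemma cramer_linear s i : row_linear (cramer s i).
Proof.
move=> A k; have [<-|ik] := eqVneq i k.
  exists ((s * \det (updrow A i x)) *: const_mx 1) => v.
  by rewrite /cramer updrow_twice rowK eqxx evZr -hgtE mulrAC.
exists ((s * hgt (row i A)) *: col k (\adj (updrow A i x))) => v.
by rewrite /cramer rowK (negbTE ik) updrow_comm // det_updrow evZr.
Qed.

Lemma cramer_solve (A : 'M[R]_D) : \det A != 0 ->
  x = \sum_i (\det (updrow A i x) / \det A) *: row i A.
Proof.
move=> dA; have dE i : \det (updrow A i x) = (x *m \adj A) 0 i.
  by rewrite det_updrow /ev colE mulmxA -colE mxE.
transitivity ((\det A)^-1 *: (x *m \adj A *m A)).
  by rewrite -mulmxA mul_adj_mx mul_mx_scalar scalerA mulVf // scale1r.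
rewrite mulmx_sum_row scaler_sumr; apply: eq_bigr => i _.
by rewrite scalerA dE mulrC.
Qed.

Lemma det_updrow_comb (A : 'M[R]_D) (b : 'I_D -> R) i :
  x = \sum_j b j *: row j A -> \det (updrow A i x) = b i * \det A.
Proof.
move=> xE; rewrite det_updrow /ev.
have -> : x = (\row_j b j) *m A by rewrite mulmx_sum_row xE; apply: eq_bigr => j _; rewrite mxE.
rewrite -mulmxA colE [A *m _]mulmxA mul_mx_adj mul_scalar_mx -scalemxAr -colE !mxE.
by rewrite mulrC.
Qed.
End Cramer.

Section Overlap.
Variables (R : realType) (d n : nat).
Local Notation D := d.+1.
Local Notation V := 'rV[R]_D.
Variables (pt : 'I_D -> 'I_n -> V).
Hypothesis pt_pos : forall i a j, 0 < pt i a 0 j.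
Hypothesis pt_aff : forall i a, affpt (pt i a).
Hypothesis pt_gp : forall l : 'cV[R]_D, l != 0 ->
  (#|[set p : 'I_D * 'I_n | ev (pt p.1 p.2) l == 0%R]| <= d)%N.
Local Notation tup := {ffun 'I_D -> 'I_n}.

Lemma low_rank_annihilator (U : 'M[R]_D) : (\rank U <= d)%N ->
  exists2 l : 'cV[R]_D, l != 0 & U *m l = 0.
Proof.
move=> rU; have : kermx U^T != 0.
  by rewrite -mxrank_eq0 mxrank_ker mxrank_tr -lt0n subn_gt0.
case/rowV0Pn => v /sub_kermxP vU v0; exists v^T; first by rewrite trmx_eq0.
by apply: trmx_inj; rewrite trmx_mul trmxK vU trmx0.
Qed.

Lemma few_in_subspace i (U : 'M[R]_D) : (\rank U <= d)%N ->
  (#|[set a | (pt i a <= U)%MS]| <= d)%N.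
Proof.
move=> /low_rank_annihilator[l l0 Ul]; apply: leq_trans (pt_gp l0).
rewrite -(card_imset _ (_ : injective (fun a => (i, a)))); last by move=> a b [].
apply: subset_leq_card; apply/subsetP => p /imsetP[a]; rewrite inE => /submxP[w wE] ->.
by rewrite inE /= /ev wE -mulmxA Ul mulmx0 mxE.
Qed.

Lemma det_transversal (f : tup) : \det (\matrix_(j < D) pt j (f j)) != 0.
Proof.
set A := \matrix_(j < D) _; rewrite -unitfE -unitmxE -row_full_unit /row_full.
rewrite eqn_leq rank_leq_row ltnNge; apply/negP => /low_rank_annihilator[l l0 Al].
have := pt_gp l0; rewrite leqNgt => /negP; apply.
have inj : injective (fun j : 'I_D => (j, f j)) by move=> i j [].
apply: (@leq_trans #|[set (j, f j) | j : 'I_D]|); first by rewrite card_imset // card_ord.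
apply: subset_leq_card; apply/subsetP => p /imsetP[j _ ->].
by rewrite inE /= /ev -(rowK (fun j => pt j (f j))) -row_mul -/A Al row0 mxE.
Qed.

Variable a : nat.
Let e0 := (4 * D`!)%N.
Let m := ((4 * (4 ^ D * e0) * a + D * D) * (D ^ D * D) + D)%N.
Let B := (2 * (4 ^ D * e0) * (m.+1 ^ D * (m * 2).+1 ^ D))%N.

(** A tuple contains [x] exactly when the Cramer numerators have the sign of
    the determinant, so one of the two global signs [s] accounts for half of
    the selected tuples.  Conversely the numerators sum to the determinant,
    which is nonzero by general position, so its sign need not be imposed. *)
Theorem lifted_overlap : ((3 * m.+1 ^ D) ^ D < 2 ^ a)%N -> (0 < n)%N ->
  (2 * D`! * (D * d) <= n)%N ->
  exists (x : V) (S : 'I_D -> {set 'I_n}), [/\ affpt x,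
    (forall i, n <= #|S i| * B)%N &
    forall f : tup, (forall i, f i \in S i) -> in_tail_cone pt 0 x f].
Proof.
move=> ha n0 hn.
have [x xA xE] := rainbow_selection pt_pos pt_aff few_in_subspace (Ordinal n0) hn.
pose A (f : tup) := \matrix_(j < D) pt j (f j).
have hgtA (f : tup) i : hgt (row i (A f)) = 1 by rewrite rowK; apply/eqP/pt_aff.
pose E (s : R) := [set f : tup | [forall i, 0 <= cramer x s i (A f)]].
have [s [ss Es]] : exists s : R, (s != 0) /\ (n ^ D <= e0 * #|E s|)%N.
  have sub : [set f : tup | `[< in_tail_cone pt 0 x f >]] \subset E 1 :|: E (-1).
    apply/subsetP => f; rewrite !inE => /asboolP[b b0 xb].
    have xb' : x = \sum_j b j *: row j (A f) by rewrite xb; apply: eq_bigr => j _; rewrite rowK.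
    have cE s i : cramer x s i (A f) = b i * (s * \det (A f)).
      by rewrite /cramer hgtA mulr1 (det_updrow_comb _ xb') mulrCA.
    case: (leP 0 (\det (A f))) => dA; apply/orP; [left|right]; apply/forallP => i.
      by rewrite cE mul1r mulr_ge0.
    by rewrite cE mulN1r mulr_ge0 // oppr_ge0 ltW.
  have := leq_trans (subset_leq_card sub) (leq_card_setU _ _).
  move: xE; set X := #|[set f : tup | _]| => xE XE.
  have : (n ^ D <= e0 * #|E 1%R|)%N || (n ^ D <= e0 * #|E (-1)%R|)%N.
    move: xE XE; rewrite /e0; set u := #|E 1|; set v := #|E (-1)|; set F := D`!; set N := (n ^ D)%N.
    move=> h1 h2; have h3 : (2 * F * X <= 2 * F * (u + v))%N by rewrite leq_mul2l h2 orbT.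
    move: h1 h3; clear; nia.
  by case/orP=> h; [exists 1|exists (-1)]; split; rewrite ?oppr_eq0 ?oner_eq0.
have e0p : (0 < e0)%N by rewrite muln_gt0 fact_gt0.
have cI : #|'I_D| = D by rewrite card_ord.
have [|S [cS hS]] := @complete_subfamily R D n 'I_D pt (cramer x s)
   (cramer_linear x s) e0 a e0p n0 _ Es; first by rewrite cI.
exists x, S; split=> //; first by move=> i; have := cS i; rewrite cI.
move=> f fS; have dA := det_transversal f.
have xS := cramer_solve x dA.
have h i : 0 <= s * \det (updrow (A f) i x).
  by have := hS f fS i; rewrite /cramer hgtA mulr1.
have sumE : \sum_i \det (updrow (A f) i x) = \det (A f).
  move/(congr1 (@hgt R D)): xS; rewrite hgt_sum (eqP xA).
  under eq_bigr => i _ do rewrite hgtZ hgtA mulr1.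
  by rewrite -mulr_suml => /esym/(canRL (divfK dA)); rewrite mul1r.
have sdA : 0 < s * \det (A f).
  by rewrite lt_def mulf_neq0 //= -sumE mulr_sumr sumr_ge0.
exists (fun i => \det (updrow (A f) i x) / \det (A f)) => [i|].
  have -> : \det (updrow (A f) i x) / \det (A f) = (s * \det (updrow (A f) i x)) / (s * \det (A f)).
    by rewrite -mulf_div divff // mul1r.
  by rewrite divr_ge0 // ltW.
by rewrite {1}xS; apply: eq_bigr => i _; rewrite rowK.
Qed.
End Overlap.

(** * Powers of two bounding the parameters *)

Section Exponents.
Local Open Scope nat_scope.
Variables d L : nat.
Local Notation D := d.+1.
Hypotheses (d0 : 0 < d) (L0 : 0 < L) (DL : D <= 2 ^ L).

Lemma fact_le_expn k j : k <= j -> k`! <= j ^ k.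
Proof. by elim: k => // k IH kj; rewrite factS expnS leq_mul // IH // ltnW. Qed.

Lemma mul_pow2 x y p q : x <= 2 ^ p -> y <= 2 ^ q -> x * y <= 2 ^ (p + q).
Proof. by move=> h1 h2; rewrite expnD leq_mul. Qed.

Lemma add_pow2 x y p : x <= 2 ^ p -> y <= 2 ^ p -> x + y <= 2 ^ p.+1.
Proof. by move=> h1 h2; rewrite expnS mul2n -addnn leq_add. Qed.

Lemma exp_pow2 x p k : x <= 2 ^ p -> x ^ k <= 2 ^ (p * k).
Proof. by move=> h; rewrite expnM; apply: leq_expn. Qed.

Lemma pow2_le x p q : x <= 2 ^ p -> p <= q -> x <= 2 ^ q.
Proof. by move=> h pq; apply: leq_trans h _; rewrite leq_exp2l. Qed.

(** The exponent [a] of the union bound in [cutting_lemma]; since the size of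
    the sample is proportional to [a], it has to beat its own logarithm. *)
Definition sample_exponent := 2 * D + 20 * (D * L) * (D * D) + 1.
Local Notation e0 := (4 * D`!).
Local Notation m := ((4 * (4 ^ D * e0) * sample_exponent + D * D) * (D ^ D * D) + D).
Local Notation B := (2 * (4 ^ D * e0) * (m.+1 ^ D * (m * 2).+1 ^ D)).

Lemma pow2_fact : D`! <= 2 ^ (L * D).
Proof. exact: leq_trans (fact_le_expn (leqnn D)) (exp_pow2 D DL). Qed.

Lemma pow2_emax : 4 ^ D * e0 <= 2 ^ (4 * (D * L)).
Proof.
have h4 : 4 ^ D <= 2 ^ (2 * D) by exact: (@exp_pow2 4 2 D).
apply: pow2_le (mul_pow2 h4 (@mul_pow2 4 _ 2 _ (leqnn 4) pow2_fact)) _.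
have : D <= D * L by rewrite leq_pmulr.
rewrite (mulnC L D); move: d0; clear; set X := D * L; lia.
Qed.

Lemma pow2_sample_exponent : sample_exponent <= 2 ^ (5 + 4 * L).
Proof.
have hL : L <= 2 ^ L by rewrite ltnW // ltn_expl.
have hX : D * L * (D * D) <= 2 ^ (4 * L).
  by apply: pow2_le (mul_pow2 (mul_pow2 DL hL) (mul_pow2 DL DL)) _; clear; lia.
rewrite expnD (_ : 2 ^ 5 = 32) //; apply: (@leq_trans (32 * (D * L * (D * D)))); last by rewrite leq_mul2l hX orbT.
have h1 : D <= D * L * (D * D).
  apply: (@leq_trans (D * L)); first by rewrite leq_pmulr.
  by rewrite leq_pmulr.
rewrite /sample_exponent -!mulnA; move: h1; rewrite -!mulnA; move: d0; clear.
set X := D * (L * (D * D)); lia.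
Qed.

Lemma pow2_m : m.+1 <= 2 ^ (20 * (D * L)).
Proof.
have X1 : D <= D * L by rewrite leq_pmulr.
have X2 : 2 * L <= D * L by rewrite leq_mul2r orbC ltnS d0.
have h1 := mul_pow2 (@mul_pow2 4 _ 2 _ (leqnn 4) pow2_emax) pow2_sample_exponent.
have h2 : D * D <= 2 ^ (2 + 4 * (D * L) + (5 + 4 * L)).
  by apply: pow2_le (mul_pow2 DL DL) _; clear; lia.
have h3 := mul_pow2 (add_pow2 h1 h2) (mul_pow2 (exp_pow2 D DL) DL).
have h4 : D.+1 <= 2 ^ ((2 + 4 * (D * L) + (5 + 4 * L)).+1 + (L * D + L)).
  by rewrite -[D.+1]addn1; apply: pow2_le (add_pow2 DL (_ : 1 <= 2 ^ L)) _; rewrite ?expn_gt0 //; clear; lia.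
rewrite -addnS; apply: pow2_le (add_pow2 h3 h4) _.
rewrite (mulnC L D); move: X1 X2 d0 L0; clear; set X := D * L; lia.
Qed.

Lemma sample_exponent_large : (3 * m.+1 ^ D) ^ D < 2 ^ sample_exponent.
Proof.
have h := exp_pow2 D (@mul_pow2 3 _ 2 _ isT (exp_pow2 D pow2_m)).
apply: leq_ltn_trans h _; rewrite ltn_exp2l // /sample_exponent addn1 ltnS mulnDl leq_add2l.
by rewrite -(mulnA _ D D).
Qed.

(** The exponents are collected in units of [D ^ 2 * L], and [D <= 2 * d]. *)
Lemma exponent_le x : x <= 46 * (D * L * D) -> x <= 184 * (d * d * L).
Proof.
move=> h; have D2 : D <= 2 * d by move: d0; clear; lia.
have : D * L * D <= 2 * d * L * (2 * d) by rewrite leq_mul // leq_mul2r D2 orbT.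
have -> : 2 * d * L * (2 * d) = 4 * (d * d * L) by clear; nia.
by move: h; set X := D * L * D; set Y := d * d * L; clear; lia.
Qed.

Lemma pow2_B : B <= 2 ^ (184 * (d * d * L)).
Proof.
have hm := pow2_m; move: (m) hm => k hk.
have h1 : (k * 2).+1 <= 2 ^ (20 * (D * L)).+1.
  by rewrite expnS mulnC; move: hk; clear; set z := 2 ^ _; lia.
have h2 := mul_pow2 (@mul_pow2 2 _ 1 _ isT pow2_emax) (mul_pow2 (exp_pow2 D hk) (exp_pow2 D h1)).
apply: pow2_le h2 _; apply: exponent_le.
have X1 : D * L <= D * L * D by rewrite leq_pmulr.
have X2 : D <= D * L * D by rewrite -mulnA leq_pmulr // muln_gt0 L0.
move: X1 X2; rewrite mulSn -!mulnA; set X := D * (L * D); set Y := D * L; clear; lia.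
Qed.

Lemma pow2_small : 2 * D`! * (D * d) <= 2 ^ (184 * (d * d * L)).
Proof.
have dL : d <= 2 ^ L by exact: ltnW.
apply: pow2_le (mul_pow2 (@mul_pow2 2 _ 1 _ isT pow2_fact) (mul_pow2 DL dL)) _.
apply: exponent_le.
have X1 : D * L <= D * L * D by rewrite leq_pmulr.
have X2 : L <= D * L * D by rewrite mulnAC leq_pmull.
have X3 : D <= D * L * D by rewrite -mulnA leq_pmulr // muln_gt0 L0.
rewrite (mulnC L D); move: X1 X2 X3; set X := D * L * D; set Y := D * L; clear; lia.
Qed.
End Exponents.

(** * From Euclidean space to the standard simplex *)

Section Lift.
Variables (R : realType) (d : nat) (M : R).
Hypothesis M0 : 0 < M.
Local Notation D := d.+1.
Implicit Types x q : 'rV[R]_d.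

Let c : R := (1 + 2 * d%:R * M)^-1.
Let c0 : 0 < c.
Proof. by rewrite invr_gt0 ltr_pwDl // !mulr_ge0 // ltW. Qed.

(** The affine map sending the cube [(-M, M)^d] inside the open standard
    simplex. *)
Definition lift_pt x : 'rV[R]_D :=
  \row_i (if unlift ord0 i is Some j then c * (x 0 j + M)
          else 1 - \sum_j c * (x 0 j + M)).

Lemma lift_pt0 x : lift_pt x 0 ord0 = 1 - \sum_j c * (x 0 j + M).
Proof. by rewrite mxE unlift_none. Qed.

Lemma lift_ptS x j : lift_pt x 0 (lift ord0 j) = c * (x 0 j + M).
Proof. by rewrite mxE liftK. Qed.

Lemma lift_pt_aff x : affpt (lift_pt x).
Proof.
apply/eqP; rewrite /hgt big_ord_recl; under eq_bigr => j _ do rewrite lift_ptS.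
by rewrite lift_pt0 subrK.
Qed.

Lemma lift_pt_pos x : (forall j, `|x 0 j| < M) -> forall i, 0 < lift_pt x 0 i.
Proof.
move=> xM i; have [j ->|->] := unliftP ord0 i.
  by rewrite lift_ptS mulr_gt0 //; have := xM j; rewrite ltr_norml => /andP[h _]; lra.
rewrite lift_pt0 subr_gt0 -mulr_sumr mulrC ltr_pdivrMr ?mul1r; last by rewrite -invr_gt0.
apply: (@le_lt_trans _ _ (2 * d%:R * M)); last by rewrite ltrDr.
apply: (@le_trans _ _ (\sum_(j < d) 2 * M)).
  by apply: ler_sum => j _; have := xM j; rewrite ltr_norml => /andP[_ h]; lra.
by rewrite sumr_const card_ord -[_ *+ d]mulr_natr mulrAC.
Qed.

Lemma lift_pt_inj : injective lift_pt.
Proof.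
move=> x y /rowP e; apply/rowP => j; have := e (lift ord0 j); rewrite !lift_ptS.
by move/(mulfI (lt0r_neq0 c0))/addIr.
Qed.

Lemma lift_pt_comb (I : finType) (w : I -> R) (v : I -> 'rV[R]_d) : \sum_i w i = 1 ->
  lift_pt (\sum_i w i *: v i) = \sum_i w i *: lift_pt (v i).
Proof.
move=> w1.
have E j : c * ((\sum_i w i *: v i) 0 j + M) = \sum_i w i * (c * (v i 0 j + M)).
  rewrite -[M in LHS]mul1r -w1 mulr_suml summxE -big_split /= mulr_sumr.
  by apply: eq_bigr => i _; rewrite mxE; ring.
apply/rowP => k; rewrite summxE; under [RHS]eq_bigr => i _ do rewrite mxE.
have [j ->|->] := unliftP ord0 k.
  by rewrite lift_ptS E; apply: eq_bigr => i _; rewrite lift_ptS.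
rewrite lift_pt0 (eq_bigr _ (fun j _ => E j)).
rewrite exchange_big /= -w1 -sumrB; apply: eq_bigr => i _.
by rewrite lift_pt0 mulrBr mulr1 mulr_sumr.
Qed.

Lemma ev_lift_pt x (l : 'cV[R]_D) : ev (lift_pt x) l =
  \sum_(j < d) (c * (l (lift ord0 j) 0 - l ord0 0)) * x 0 j +
  (l ord0 0 + \sum_(j < d) c * M * (l (lift ord0 j) 0 - l ord0 0)).
Proof.
rewrite /ev mxE big_ord_recl; under eq_bigr => j _ do rewrite lift_ptS.
rewrite lift_pt0.
rewrite mulrBl mul1r mulr_suml -addrA [RHS]addrCA; congr (_ + _).
rewrite addrC -sumrB -big_split /=; apply: eq_bigr => j _; ring.
Qed.
End Lift.

Section Main.
Variables (R : realType) (d n : nat).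
Local Notation D := d.+1.
Variables (P : 'I_D -> {fset 'rV[R]_d}).
Hypothesis Pn : forall i, #|` P i| = n.
Hypothesis Pdisj : forall i j, i != j -> [disjoint P i & P j]%fset.
Hypothesis Pgp : general_position (\bigcup_(i in 'I_D) P i)%fset.

Definition colour_pt (i : 'I_D) (a : 'I_n) : 'rV[R]_d := nth 0 (enum_fset (P i)) a.

Lemma colour_pt_in i a : colour_pt i a \in P i.
Proof. by rewrite /colour_pt mem_nth // Pn. Qed.

Lemma colour_pt_inj : injective (fun p : 'I_D * 'I_n => colour_pt p.1 p.2).
Proof.
move=> [i a] [j b] /= e; have [ij|ij] := eqVneq i j; last first.
  have /fdisjointP/(_ _ (colour_pt_in i a)) := Pdisj ij.
  by rewrite e colour_pt_in.
subst j; congr (_, _); apply: val_inj; apply/eqP.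
have sz : size (enum_fset (P i)) = n by exact: Pn.
by rewrite -(nth_uniq 0 _ _ (fset_uniq (P i))) ?sz ?ltn_ord //; apply/eqP; exact: e.
Qed.

Lemma exists_bound : exists2 M : R, 0 < M & forall i a j, `|colour_pt i a 0 j| < M.
Proof.
exists (1 + \sum_(p : 'I_D * 'I_n) \sum_j `|colour_pt p.1 p.2 0 j|).
  by rewrite ltr_pwDl // sumr_ge0 // => p _; apply: sumr_ge0.
move=> i a j; rewrite ltr_pwDl // (bigD1 (i, a)) //= (bigD1 j) //= -addrA lerDl.
by rewrite addr_ge0 ?sumr_ge0 // => p _; apply: sumr_ge0.
Qed.

(** A functional vanishing at [D] lifted points pulls back to an affine
    function vanishing at [D] of the given points.  It is not constant: a
    constant would be zero, and then so would be the functional. *)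
Lemma lift_general_position (M : R) (M0 : 0 < M) (l : 'cV[R]_D) : l != 0 ->
  (#|[set p : 'I_D * 'I_n | ev (lift_pt M (colour_pt p.1 p.2)) l == 0%R]%SET| <= d)%N.
Proof.
move=> l0; rewrite leqNgt; apply/negP => /card_geqP[s [us ss sZ]].
pose T := [fset x in [seq colour_pt p.1 p.2 | p <- s]]%fset.
have T_sub : (T `<=` \bigcup_(i in 'I_D) P i)%fset.
  apply/fsubsetP => x; rewrite !inE => /mapP[[i a] _ ->].
  by apply/bigfcupP; exists i; rewrite ?colour_pt_in ?mem_index_enum.
have T_card : #|` T| = D.
  by rewrite card_fseq undup_id ?size_map // map_inj_uniq //; exact: colour_pt_inj.
apply: (Pgp T_sub T_card).
pose cc : R := (1 + 2 * d%:R * M)^-1.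
have cc0 : cc != 0 by rewrite invr_eq0 lt0r_neq0 // ltr_pwDl // !mulr_ge0 // ltW.
pose nrm : 'rV[R]_d := \row_j (cc * (l (lift ord0 j) 0 - l ord0 0)).
pose b : R := l ord0 0 + \sum_(j < d) cc * M * (l (lift ord0 j) 0 - l ord0 0).
have onH p : p \in s -> \sum_j nrm 0 j * colour_pt p.1 p.2 0 j = - b.
  move=> /sZ; rewrite inE => /eqP; rewrite ev_lift_pt => /eqP; rewrite addr_eq0 => /eqP <-.
  by apply: eq_bigr => j _; rewrite mxE.
exists [set x : 'rV[R]_d | \sum_(j < d) nrm 0 j * x 0 j = - b]%classic; last first.
  by move=> x; rewrite inE => /mapP[p ps ->]; apply: onH.
exists nrm, (- b); split=> //; apply: contraNneq l0 => nrm0.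
have lE j : l (lift ord0 j) 0 = l ord0 0.
  have /rowP/(_ j) := nrm0; rewrite !mxE => /eqP; rewrite mulf_eq0 (negbTE cc0) /=.
  by rewrite subr_eq0 => /eqP.
have [p ps] : exists p, p \in s by case: (s) ss => // p s' _; exists p; rewrite mem_head.
have := onH p ps; rewrite nrm0 big1 => [|j _]; last by rewrite mxE mul0r.
rewrite /b big1 ?addr0 => [/eqP|j _]; last by rewrite lE subrr mulr0.
rewrite eq_sym oppr_eq0 => /eqP l00.
apply/eqP/matrixP => k r; rewrite !ord1 mxE.
by have [j ->|->] := unliftP ord0 k; rewrite ?lE.
Qed.

(** Below the threshold of [lifted_overlap] any rainbow simplex and its
    barycentre will do. *)
Lemma pow2_subfamily (L : nat) : (0 < d)%N -> (0 < n)%N -> (D <= 2 ^ L)%N -> (0 < L)%N ->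
  exists (q : 'rV[R]_d) (P' : 'I_D -> {fset 'rV[R]_d}),
    [/\ forall i, (P' i `<=` P i)%fset,
        forall i, (n <= #|` P' i| * 2 ^ (184 * (d * d * L)))%N &
        forall v : 'I_D -> 'rV[R]_d, (forall i, v i \in P' i) -> closed_simplex v q].
Proof.
move=> d0 n0 DL L0.
have [nsmall|nlarge] := ltnP n (2 * D`! * (D * d)).
  pose a0 := Ordinal n0.
  exists (\sum_(i < D) D%:R^-1 *: colour_pt i a0), (fun i => [fset colour_pt i a0]%fset); split.
  - by move=> i; rewrite fsub1set colour_pt_in.
  - move=> i; rewrite cardfs1 mul1n; apply: leq_trans (ltnW nsmall) _; exact: pow2_small.
  move=> v vE; exists (fun=> D%:R^-1); split.
  - by move=> i; rewrite invr_ge0.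
  - by rewrite sumr_const card_ord -[_ *+ _]mulr_natr mulVf // pnatr_eq0.
  - by apply: eq_bigr => i _; have := vE i; rewrite inE => /eqP ->.
have [M M0 hM] := exists_bound.
pose pt i a := lift_pt M (colour_pt i a).
have pt_pos i a j : 0 < pt i a 0 j by apply: lift_pt_pos.
have pt_aff i a : affpt (pt i a) by apply: lift_pt_aff.
have pt_gp := lift_general_position M0.
have [x [S [xA cS hS]]] := lifted_overlap pt_pos pt_aff pt_gp (sample_exponent_large d0 L0 DL) n0 nlarge.
have S0 i : exists a, a \in S i.
  apply/card_gt0P; have := cS i; rewrite lt0n; case: eqP => // ->.
  by rewrite mul0n leqn0 => /eqP nz; move: n0; rewrite nz.
have /choice[g gS] := S0.
have cell (f : {ffun 'I_D -> 'I_n}) : (forall i, f i \in S i) ->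
    exists b : 'I_D -> R, [/\ forall i, 0 <= b i, \sum_i b i = 1 & x = \sum_i b i *: pt i (f i)].
  move=> fS; have [b b0 xb] := hS f fS; exists b; split=> //.
  move/eqP: xA; rewrite xb hgt_sum => <-.
  by apply: eq_bigr => i _; rewrite hgtZ (eqP (pt_aff _ _)) mulr1.
have [|b0 [_ b01 xb0]] := cell [ffun i => g i]; first by move=> i; rewrite ffunE.
pose q := \sum_i b0 i *: colour_pt i (g i).
have qx : lift_pt M q = x.
  by rewrite lift_pt_comb // xb0; apply: eq_bigr => i _; rewrite ffunE.
exists q, (fun i => [fset y in [seq colour_pt i a | a <- enum (S i)]]%fset); split.
- by move=> i; apply/fsubsetP => y; rewrite inE => /mapP[a _ ->]; exact: colour_pt_in.
- move=> i; rewrite card_fseq undup_id; last first.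
    rewrite map_inj_uniq ?enum_uniq // => a b e.
    by have [] := @colour_pt_inj (i, a) (i, b) e.
  rewrite size_map -cardE; apply: leq_trans (cS i) _; rewrite leq_mul2l; apply/orP; right.
  exact: pow2_B.
move=> v vS.
have /choice[f fE] i : exists a, a \in S i /\ v i = colour_pt i a.
  by have := vS i; rewrite inE => /mapP[a]; rewrite mem_enum => aS ->; exists a.
have [|b [b_ge0 b1 xb]] := cell [ffun i => f i]; first by move=> i; rewrite ffunE; case: (fE i).
exists b; split=> //; apply: (@lift_pt_inj R d M M0); rewrite qx xb lift_pt_comb //.
by apply: eq_bigr => i _; rewrite ffunE; case: (fE i) => _ ->.
Qed.
End Main.

Theorem theorem1p6 (R : realType) :
  exists2 C : R, 0 < C &
    forall (d n : nat) (P : 'I_d.+1 -> {fset 'rV[R]_d}),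
      (forall i, #|` P i| = n) ->
      (forall i j, i != j -> [disjoint P i & P j]%fset) ->
      general_position (\bigcup_(i in 'I_d.+1) P i)%fset ->
      exists (q : 'rV[R]_d) (P' : 'I_d.+1 -> {fset 'rV[R]_d}),
        [/\ forall i, (P' i `<=` P i)%fset,
            forall i, (#|` P' i|)%:R >=
              2 `^ (- (C * d%:R ^+ 2 * ln d.+1%:R)) * (#|` P i|)%:R
          & forall v : 'I_d.+1 -> 'rV[R]_d, (forall i, v i \in P' i) ->
              closed_simplex v q].
Proof.
have ln2 : 0 < ln 2 :> R by rewrite ln_gt0 // ltr1n.
exists (368 / ln 2); first by rewrite divr_gt0.
move=> d n P Pn Pdisj Pgp.
case: (posnP d) => [dz|d0].
  subst d; exists 0, P; split=> // [i|v _].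
    by rewrite expr0n /= mulr0 mul0r oppr0 powRr0 mul1r.
  exists (fun=> 1); split=> //; first by rewrite big_ord1.
  by apply/rowP => -[].
case: (posnP n) => [nz|n0].
  subst n; exists 0, P; split=> // [i|v vP].
    by rewrite Pn mulr0.
  by have := vP ord0; rewrite (cardfs0_eq (Pn ord0)) inE.
pose L := up_log 2 d.+1.
have L0 : (0 < L)%N by rewrite up_log_gt0.
have DL : (d.+1 <= 2 ^ L)%N by apply: up_logP.
have [q [P' [P'P cP' hP']]] := pow2_subfamily Pn Pdisj Pgp d0 n0 DL L0.
exists q, P'; split=> // i; rewrite Pn.
set N := (184 * (d * d * L))%N in cP'.
have d1 : 1 <= d%:R :> R by rewrite ler1n.
have lnd : ln 2 <= ln d.+1%:R :> R.
  by rewrite ler_ln ?posrE ?ltr0n // ler_nat.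
(* As 2 ^ (L - 1) <= d + 1, the exponent L is at most 2 ln (d + 1) / ln 2,
   which turns the constant 184 into 368 / ln 2. *)
have LE : L%:R * ln 2 <= 2 * ln d.+1%:R :> R.
  have h : (2 ^ L.-1 <= d.+1)%N by rewrite ltnW // up_log_gtn.
  have : L.-1%:R * ln 2 <= ln d.+1%:R :> R.
    rewrite mulrC mulr_natr -lnXn // -natrX ler_ln ?posrE ?ltr0n ?expn_gt0 //.
    by rewrite ler_nat.
  by rewrite -[in L%:R](prednK L0) -natr1 mulrDl mul1r; lra.
have NE : N%:R <= 368 / ln 2 * d%:R ^+ 2 * ln d.+1%:R :> R.
  have -> : N%:R = 184 * d%:R ^+ 2 / ln 2 * (L%:R * ln 2) :> R.
    by rewrite !natrM expr2; field; rewrite lt0r_neq0.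
  have -> : 368 / ln 2 * d%:R ^+ 2 * ln d.+1%:R = 184 * d%:R ^+ 2 / ln 2 * (2 * ln d.+1%:R) :> R.
    by ring.
  by rewrite ler_wpM2l // divr_ge0 ?(ltW ln2) // mulr_ge0 ?sqr_ge0.
rewrite powRN mulrC ler_pdivrMr ?powR_gt0 //.
apply: (@le_trans _ _ (#|` P' i| * 2 ^ N)%N%:R); first by rewrite ler_nat.
rewrite natrM natrX ler_wpM2l // -(@powR_mulrn _ 2 N) //.
by apply: ler_powR => //; rewrite ler1n.
Qed.
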